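(* Let $g\in\mathbb{F}_q[T]$ be monic with $\deg(g)\ge1$, let $\ell\in\mathbb{F}_q[T]$ be monic, and let $c\in\mathbb{F}_q[T]$ be such that $\ell\mid g$ and $(c,g)=1$. Let $\chi$ be a primitive Dirichlet character modulo $\ell$. Then, for all $u\in\mathbb{C}$ (as an identity of meromorphic functions of $u$), $$\mathcal{R}_2\Big(u;\chi,\frac cg\Big)=\overline\chi(-c)\,(qu^2)^{\deg(g)-1}\sum_{\lambda\in\mathbb{F}_q^\times}\mathcal{B}_\lambda(u;\chi)\,\mathcal{R}_2\Big(\frac{1}{qu};\chi,\frac{\lambda\overline c}{g}\Big),$$ where $\overline c$ is an inverse of $c$ modulo $g$ and $$\mathcal{B}_\lambda(u;\chi)=\sum_{\eta_1,\eta_2\in\{0,1\}}(-1)^{\eta_1+\eta_2}\frac{\mathrm{Kl}_\chi\big(\eta_1-1,(1-\eta_2)\lambda\big)}{q(1-qu)^{\eta_1+\eta_2}}.$$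
   Context: $q=p^\eta$ is a prime power; $e_q(y)=\exp(2\pi i\,\mathrm{Tr}_{\mathbb{F}_q/\mathbb{F}_p}(y)/p)$ for $y\in\mathbb{F}_q$; for $\alpha=\sum_{j\le N}\alpha_jT^j\in\mathbb{F}_q((1/T))$, $e(\alpha)=e_q(\alpha_{-1})$. $\mathcal{M}$ is the set of monic polynomials in $\mathbb{F}_q[T]$. $r_\chi(f)=\sum_{g\mid f}\chi(g)$ over monic divisors $g$. For $\alpha,\beta\in\mathbb{F}_q$, $\mathrm{Kl}_\chi(\alpha,\beta)=\sum_{\gamma\in\mathbb{F}_q^\times}\chi(\gamma)e_q(\alpha\gamma+\beta\gamma^{-1})$ (using the restriction of $\chi$ to $\mathbb{F}_q^\times$). $\mathcal{R}_2(u;\chi,c/g)=\sum_{f\in\mathcal{M}}r_\chi(f)e(cf/g)u^{\deg f}$ for $|u|<1/q$, extended meromorphically to $\mathbb{C}$. The modulus $\ell$ need not be irreducible, and $\ell=1$ (with $\chi=1$) is allowed. *)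

(* Defs.v *)
From HB Require Import structures.
From mathcomp Require Import all_boot all_order all_algebra.
From mathcomp Require Import vector falgebra fieldext galois finfield.
From mathcomp Require Import all_classical all_reals all_analysis.
From mathcomp Require Import complex zify.

Set Implicit Arguments.
Unset Strict Implicit.
Unset Printing Implicit Defensive.

Import Order.TTheory GRing.Theory Num.Theory.
Import numFieldNormedType.Exports.
Local Open Scope classical_set_scope.
Local Open Scope ring_scope.

(* Degree of a nonzero polynomial. *)
Definition deg (A : nzRingType) (f : {poly A}) : nat := (size f).-1.

(** * Meromorphic functions on the complex plane

    Meromorphic functions are represented by total functions [f : R[i] -> R[i]];
    the value of [f] at a pole carries no information, and [f] has its true
    value everywhere else (there are no unfilled removable singularities). *)
Section Meromorphic.
Variable R : realType.
Local Notation C := R[i].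

Definition psum_to (a : nat -> C) (z s : C) : Prop :=
  (series (fun n => a n * z ^+ n) : nat -> C^o) @ \oo --> (s : C^o).

Definition analytic_at (f : C -> C) (z0 : C) : Prop :=
  exists a : nat -> C,
    \forall z \near (z0 : C^o), psum_to a (z - z0) (f z).

(* Pole of order N.+1. *)
Definition pole_at (f : C -> C) (z0 : C) : Prop :=
  exists (N : nat) (a : nat -> C), a 0%N != 0 /\
    \forall z \near (z0 : C^o)^',
      psum_to a (z - z0) ((z - z0) ^+ N.+1 * f z).

Definition meromorphic (f : C -> C) : Prop :=
  forall z0 : C, analytic_at f z0 \/ pole_at f z0.

End Meromorphic.

(** * Laurent series in 1/T *)
Section Laurent.
Variable F : fieldType.

(* [alpha j] is the coefficient of T^j. *)
Record laurent : Type := Laurent {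
  laurent_coef :> int -> F;
  laurent_bounded : exists N : int, forall j, N < j -> laurent_coef j = 0 }.

(* For j >= 0 the coefficient of T^j in a/g is read off the polynomial part of
   a/g; the coefficient of T^-k is the constant coefficient of the polynomial
   part of T^k a/g. *)
Definition frac_coef (a g : {poly F}) (j : int) : F :=
  match j with
  | Posz n => (a %/ g)`_n
  | Negz n => ((a * 'X^(n.+1)) %/ g)`_0
  end.

Fact frac_coef_bounded (a g : {poly F}) :
  exists N : int, forall j, N < j -> frac_coef a g j = 0.
Proof.
exists (Posz (size (a %/ g))) => -[n|n] //= hn.
by rewrite nth_default // ltnW.
Qed.

Definition frac_laurent (a g : {poly F}) : laurent :=
  Laurent (frac_coef_bounded a g).

Lemma frac_coef_shift (a g : {poly F}) (m k : nat) : g != 0 ->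
  ((a * 'X^k) %/ g)`_m = frac_coef a g (m%:Z - k%:Z).
Proof.
move=> g0.
have step b i : ((b * 'X) %/ g)`_i.+1 = (b %/ g)`_i.
  rewrite {1}(divp_eq b g) mulrDl mulrAC divpD mulpK // coefD coefMX /=.
  rewrite [X in _ + X]nth_default ?addr0 //.
  rewrite size_divp // leq_subLR.
  have := ltn_modp b g; rewrite g0 => h.
  apply: leq_trans (_ : size g <= _)%N; last by case: (size g) => //= n; rewrite addnS ltnS leq_addr.
  have [->|r0] := eqVneq (b %% g) 0; first by rewrite mul0r size_poly0.
  by rewrite size_mulX.
have shift b i j : ((b * 'X^j) %/ g)`_(i + j) = (b %/ g)`_i.
  elim: j => [|j IH]; first by rewrite expr0 mulr1 addn0.
  by rewrite exprSr mulrA addnS step.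
case: (leqP k m) => km.
  by rewrite -{1}(subnK km) shift subzn.
have -> : m%:Z - k%:Z = Negz (k - m).-1.
  by rewrite NegzE prednK ?subn_gt0 // -subzn ?opprB // ltnW.
rewrite /frac_coef prednK ?subn_gt0 // -(shift _ 0%N m) add0n.
by rewrite -mulrA -exprD subnK // ltnW.
Qed.

(* [frac_laurent a g] is the expansion of a/g: its product with g is a. *)
Lemma frac_laurentP (a g : {poly F}) (n : int) : g != 0 ->
  \sum_(j < size g) g`_j * frac_laurent a g (n - j%:Z) =
  (if n is Posz m then a`_m else 0).
Proof.
move=> g0; rewrite /=.
pose k := (size g + absz n)%N; pose m := absz (n + k%:Z).
have nm : n = m%:Z - k%:Z by rewrite /m /k; lia.
have sm : (size g <= m)%N by rewrite /m /k; lia.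
have -> : \sum_(j < size g) g`_j * frac_coef a g (n - j%:Z) =
          (g * ((a * 'X^k) %/ g))`_m.
  rewrite coefM (big_ord_widen m.+1 (fun j => g`_j * frac_coef a g (n - j%:Z))).
    rewrite big_mkcond; apply: eq_bigr => j _.
    have jm : (j <= m)%N by rewrite -ltnS.
    rewrite frac_coef_shift // -subzn // nm addrAC.
    by case: ltnP => // /leq_sizeP ->; rewrite ?mul0r.
  exact: leqW.
have -> : g * ((a * 'X^k) %/ g) = a * 'X^k - (a * 'X^k) %% g.
  by rewrite {2}(divp_eq (a * 'X^k) g) addrK mulrC.
rewrite coefB [X in _ - X]nth_default ?subr0; last first.
  by rewrite (leq_trans _ sm) // ltnW // ltn_modp.
rewrite coefMXn; case: n @k @m nm {sm} => n k m nm.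
  by rewrite ifF; [congr (a`_ _) |]; lia.
by rewrite ifT //; lia.
Qed.

End Laurent.

(** * Additive characters *)
Section Additive.
Variables (R : realType) (F : finFieldType) (p : nat).
Variable charFp : p \in [pchar F].
Local Notation C := R[i].

(* F as an extension of its prime field. *)
Local Notation L := (pPrimeCharType charFp).

(* The trace from F to its prime field, as an element of 'F_p. *)
Definition trFp (y : F) : 'F_p :=
  odflt 0 [pick t : 'F_p | t%:A == galTrace 1%VS {:L} (y : L)].

Lemma trFpE (y : F) : (trFp y)%:A = galTrace 1%VS {:L} (y : L).
Proof.
have /vlineP[t tE] : galTrace 1%VS {:L} (y : L) \in 1%VS.
  exact: mem_galTrace (finField_galois (subvf _)) (memvf _).
by rewrite /trFp; case: pickP => [t' /eqP //|/(_ t)]; rewrite tE eqxx.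
Qed.

Definition e_q (y : F) : C :=
  let t : R := 2 * pi * (trFp y : nat)%:R / p%:R in (cos t +i* sin t)%C.

Definition e_laurent (alpha : laurent F) : C := e_q (alpha (-1)).

End Additive.

(** * Dirichlet characters *)
Section Dirichlet.
Variables (R : realType) (F : finFieldType).
Local Notation C := R[i].

(* Characters of (F[T]/l)^*, extended by 0 to polynomials not coprime to l. *)
Definition dirichlet_character (l : {poly F}) (chi : {poly F} -> C) : Prop :=
  [/\ chi 1 = 1,
      forall f h, chi (f * h) = chi f * chi h,
      forall f h, l %| f - h -> chi f = chi h &
      forall f, (chi f != 0) = coprimep f l].

Definition primitive_character (l : {poly F}) (chi : {poly F} -> C) : Prop :=
  dirichlet_character l chi /\
  forall m : {poly F}, m \is monic -> m %| l -> m != l ->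
    ~ exists chi' : {poly F} -> C, dirichlet_character m chi' /\
        forall f, coprimep f l -> chi f = chi' f.

End Dirichlet.

Section Estermann.
Variables (R : realType) (F : finFieldType) (p : nat).
Variable charFp : p \in [pchar F].
Variable chi : {poly F} -> R[i].
Local Notation C := R[i].

Definition r_chi (f : {poly F}) : C :=
  \sum_(d \in [set d : {poly F} | d \is monic /\ d %| f]) chi d.

Definition Kl (alpha beta : F) : C :=
  \sum_(x : F | x != 0)
    chi x%:P * e_q R charFp (alpha * x + beta * x^-1).

Definition R2_coef (c g : {poly F}) (n : nat) : C :=
  \sum_(f \in [set f : {poly F} | f \is monic /\ deg f = n])
    r_chi f * e_laurent R charFp (frac_laurent (c * f) g).

(* [G] is the meromorphic continuation of the series
   sum_f r_chi(f) e(cf/g) u^(deg f), |u| < 1/q, summed by degree. *)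
Definition is_R2 (c g : {poly F}) (G : C -> C) : Prop :=
  meromorphic G /\
  forall u : C, `|u| < (#|F|%:R)^-1 -> psum_to (R2_coef c g) u (G u).

Definition calB (lambda : F) (u : C) : C :=
  \sum_(e1 < 2) \sum_(e2 < 2)
    (-1) ^+ (e1 + e2) *
    (Kl (e1%:R - 1) ((1 - e2%:R) * lambda) /
     (#|F|%:R * (1 - #|F|%:R * u) ^+ (e1 + e2))).

End Estermann.

(* Main.v *)
(** Splitting d in r_chi(f) = sum_(d | f) chi(d) and sorting both d and f/d by
    residue class modulo g gives, with n = deg g and psi(x) = e(x/g),
      R_2(u; c/g) = sum_(a mod g) chi(a) zeta(u, a) zetahat(u, ca),
    where zeta(u, a) is the generating function of the monic polynomials
    congruent to a and zetahat(u, x) = sum_b psi(bx) zeta(u, b) is its finite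
    Fourier transform.  Since zeta(u, a) = u^n / (1 - qu) + [a monic] u^(deg a)
    for reduced a, R_2 is a polynomial over (1 - qu)^2.  Orthogonality of psi on
    the monic polynomials of fixed degree evaluates zetahat, whence a Hurwitz
    formula expressing zetahat(u, x) through the zeta(1/(qu), x/lambda), lambda
    in F_q^*, and by Fourier inversion zeta(u, x) through the
    zetahat(1/(qu), -lambda x).  Inserting both and substituting
    a -> mu cbar a yields the functional equation of the rational functions.  It
    passes to arbitrary meromorphic continuations, and to removable
    singularities, by the identity theorem and continuity. *)
From mathcomp Require Import fingroup vector falgebra galois finfield.
From mathcomp Require Import ring lra zify.
Require Import Defs.
From mathcomp Require Import all_boot all_order all_algebra.
From mathcomp Require Import all_classical all_reals all_analysis.
From mathcomp Require Import complex.
Import Order.TTheory GRing.Theory Num.Theory.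
Import numFieldNormedType.Exports.
Local Open Scope classical_set_scope.
Local Open Scope ring_scope.

Set Implicit Arguments.
Unset Strict Implicit.
Unset Printing Implicit Defensive.

(** * Sums over monic polynomials and residue classes *)

Section MonicSums.
Variables (F : finFieldType) (C : numFieldType).
Implicit Types (phi : {poly F} -> C).

(** Monic polynomials of degree i are parametrized by their lower coefficients, so that the sum runs
    over the finite type of row vectors. *)
Definition monic_sum (i : nat) phi : C :=
  \sum_(x : 'rV[F]_i) phi ('X^i + rVpoly x).

Definition residue_sum (n : nat) phi : C := \sum_(a : 'rV[F]_n) phi (rVpoly a).

Lemma size_monic_rV i (x : 'rV[F]_i) : size ('X^i + rVpoly x) = i.+1.
Proof. by rewrite size_polyDl size_polyXn // ltnS size_poly. Qed.

Lemma monic_rV i (x : 'rV[F]_i) : 'X^i + rVpoly x \is monic.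
Proof.
by rewrite monicE lead_coefDl ?lead_coefXn // size_polyXn ltnS size_poly.
Qed.

Lemma size_sub_monic (p : {poly F}) i :
  p \is monic -> size p = i.+1 -> (size (p - 'X^i)%R <= i)%N.
Proof.
move=> pm sp; apply/leq_sizeP => j ij; rewrite coefB coefXn.
have [->|ji] := eqVneq j i.
  by have := monicP pm; rewrite /lead_coef sp => ->; rewrite subrr.
by rewrite subr0 nth_default // sp ltn_neqAle eq_sym ji.
Qed.

Lemma degE (p : {poly F}) i : p \is monic -> (deg p == i) = (size p == i.+1).
Proof.
by move=> /monic_neq0; rewrite /deg -size_poly_gt0; case: (size p).
Qed.

(** Embeds the sums for all degrees below m into one space of row vectors, where sums over different
    degrees can be combined and exchanged. *)
Lemma sum_monic_deg m i phi : (i < m)%N ->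
  \sum_(y : 'rV[F]_m | (rVpoly y \is monic) && (deg (rVpoly y) == i))
    phi (rVpoly y) = monic_sum i phi.
Proof.
move=> im.
have K (x : 'rV[F]_i) : rVpoly (poly_rV ('X^i + rVpoly x) : 'rV[F]_m) = 'X^i + rVpoly x.
  by rewrite poly_rV_K // size_monic_rV.
rewrite (reindex_onto (fun x : 'rV[F]_i => poly_rV ('X^i + rVpoly x))
          (fun y => poly_rV (rVpoly y - 'X^i))) /=.
  apply: eq_big => x; last by rewrite K.
  by rewrite K monic_rV degE ?monic_rV // size_monic_rV addrC addKr rVpolyK !eqxx.
move=> y /andP[ym]; rewrite degE // => /eqP sy.
by rewrite poly_rV_K ?size_sub_monic // addrC subrK rVpolyK.
Qed.

End MonicSums.

Section Residues.
Variables (F : finFieldType) (C : numFieldType) (g : {poly F}).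
Hypothesis g_monic : g \is monic.
Local Notation n := (deg g).
Local Notation q := (#|F|%:R : C).
Implicit Types (phi : {poly F} -> C).

Definition mod_periodic phi := forall x y, g %| x - y -> phi x = phi y.

Lemma size_modulus : size g = n.+1.
Proof. by apply/eqP; rewrite -degE. Qed.

Lemma size_mod x : (size (x %% g)%R <= n)%N.
Proof. by rewrite -ltnS -size_modulus ltn_modp monic_neq0. Qed.

Lemma rVpoly_modK (x : {poly F}) : rVpoly (poly_rV (x %% g) : 'rV[F]_n) = x %% g.
Proof. exact/poly_rV_K/size_mod. Qed.

Lemma mod_rVpoly (a : 'rV[F]_n) : rVpoly a %% g = rVpoly a.
Proof. by rewrite modp_small // size_modulus ltnS size_poly. Qed.

Lemma dvdp_sub_mod x y : (g %| x - y) = (x %% g == y %% g).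
Proof. by rewrite /dvdp modpD modpN subr_eq0. Qed.

Lemma periodic_mod phi x : mod_periodic phi -> phi (x %% g) = phi x.
Proof. by apply; rewrite dvdp_sub_mod modp_id. Qed.

(** A map that is injective on classes permutes the finite set of reduced representatives. *)
Lemma residue_sum_reindex phi (h : {poly F} -> {poly F}) :
  mod_periodic phi -> (forall x y, g %| h x - h y -> g %| x - y) ->
  residue_sum n (fun x => phi (h x)) = residue_sum n phi.
Proof.
move=> per hinj; rewrite /residue_sum.
rewrite [RHS](reindex_inj (h := fun a => poly_rV (h (rVpoly a) %% g))) /=.
  by apply: eq_bigr => a _; rewrite rVpoly_modK periodic_mod.
move=> a b /(congr1 (fun x => rVpoly x)); rewrite !rVpoly_modK => /eqP.
rewrite -dvdp_sub_mod => /hinj; rewrite dvdp_sub_mod !mod_rVpoly => /eqP.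
exact: (can_inj (@rVpolyK _ _)).
Qed.

Lemma residue_sum_mul phi c : mod_periodic phi -> coprimep c g ->
  residue_sum n (fun x => phi (c * x)) = residue_sum n phi.
Proof.
move=> per cg; apply: (residue_sum_reindex (h := fun x => c * x)) => // x y.
by rewrite -mulrBr Gauss_dvdpr // coprimep_sym.
Qed.

Lemma residue_sum_translate phi h : mod_periodic phi ->
  residue_sum n (fun x => phi (h + x)) = residue_sum n phi.
Proof.
move=> per; apply: (residue_sum_reindex (h := fun x => h + x)) => // x y.
by rewrite opprD addrACA subrr add0r.
Qed.

Lemma card_rV k : #|'rV[F]_k| = (#|F| ^ k)%N.
Proof. by rewrite card_mx mul1n. Qed.

Lemma q_neq0 : q != 0.
Proof. by rewrite pnatr_eq0 -lt0n; apply/card_gt0P; exists 0. Qed.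

(* Averaging over translates by residues, which permute the polynomials of
   degree j. *)
Lemma monic_sum_ge j phi : mod_periodic phi -> (n <= j)%N ->
  monic_sum j phi = q ^+ (j - n) * residue_sum n phi.
Proof.
move=> per nj.
have qn0 : q ^+ n != 0 by rewrite expf_neq0 // q_neq0.
apply: (mulfI qn0); rewrite mulrA -exprD subnKC //.
transitivity (\sum_(a : 'rV[F]_n) \sum_(x : 'rV[F]_j) phi ('X^j + rVpoly x + rVpoly a)).
  rewrite -natrX mulr_natl -card_rV -sumr_const.
  apply: eq_bigr => a _; rewrite /monic_sum.
  rewrite (reindex_inj (addIr (poly_rV (rVpoly a)))) /=.
  apply: eq_bigr => x _; rewrite linearD /= poly_rV_K ?addrA //.
  by rewrite (leq_trans _ nj) // size_poly.
rewrite exchange_big /= -natrX mulr_natl -card_rV -sumr_const.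
by apply: eq_bigr => x _; exact: residue_sum_translate.
Qed.

(* The number of monic polynomials of degree i congruent to a, for a reduced. *)
Definition class_count (a : {poly F}) (i : nat) : C :=
  if (i < n)%N then ((a \is monic) && (deg a == i))%:R else q ^+ (i - n).

Lemma monic_sum_class i phi : mod_periodic phi ->
  monic_sum i phi = residue_sum n (fun a => class_count a i * phi a).
Proof.
move=> per; rewrite /residue_sum /class_count; case: ltnP => ni.
  rewrite -(sum_monic_deg (m := n)) // big_mkcond /=.
  by apply: eq_bigr => a _; case: ifP; rewrite ?mul1r ?mul0r.
by rewrite monic_sum_ge // mulr_sumr.
Qed.

End Residues.

(** * The additive character x -> e(x/g) *)

Section AdditiveCharacter.
Variables (R : realType) (F : finFieldType) (p : nat).
Variable charFp : p \in [pchar F].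
Local Notation L := (pPrimeCharType charFp).
Local Notation eq := (e_q R charFp).

Definition cis (t : R) : R[i] := (cos t +i* sin t)%C.

Lemma cisD s t : cis (s + t) = cis s * cis t.
Proof.
rewrite /cis cosD sinD; apply/eqP; rewrite eq_complex /=.
by rewrite [X in _ && (X == _)]addrC [_ * sin t]mulrC !eqxx.
Qed.

Lemma cis0 : cis 0 = 1.
Proof. by rewrite /cis cos0 sin0. Qed.

Lemma cis2pi k : cis (2 * pi * k%:R) = 1.
Proof.
elim: k => [|k IH]; first by rewrite mulr0 cis0.
by rewrite -[k.+1%:R]natr1 mulrDr cisD IH mulr1 mul1r /cis mulr_natl cos2pi sin2pi.
Qed.

Lemma p_prime : prime p. Proof. exact: pcharf_prime charFp. Qed.

Lemma trFpD : {morph trFp charFp : x y / x + y}.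
Proof.
move=> x y; pose tr := galTrace 1%VS {:L}.
have trD : tr ((x : L) + (y : L)) = tr x + tr y by rewrite /tr raddfD.
have : (trFp charFp (x + y))%:A = (trFp charFp x + trFp charFp y)%:A :> L.
  by rewrite scalerDl !trFpE -/tr trD.
move=> /eqP; rewrite -subr_eq0 -scalerBl scaler_eq0 oner_eq0 orbF subr_eq0.
by move/eqP.
Qed.

Lemma e_qD x y : eq (x + y) = eq x * eq y.
Proof.
rewrite /e_q -!/(cis _) -cisD -mulrDl -mulrDr trFpD -natrD.
set s := trFp _ x; set t := trFp _ y.
have p0 : (p%:R : R) != 0 by rewrite pnatr_eq0 -lt0n prime_gt0 ?p_prime.
rewrite [X in (_ * X / _)](_ : _ = (val (s + t))%:R) //.
have -> : val (s + t) = ((s + t) %% p)%N.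
  exact: (congr1 (fun m => ((s + t)%N %% m)%N) (Fp_cast p_prime)).
(* Addition in ['F_p] reduces modulo p; the discarded quotient only contributes a whole number of
   turns. *)
rewrite {2}(divn_eq (s + t) p) natrD natrM (mulrDr (2 * pi)) mulrDl cisD mulrA mulfK //.
by rewrite cis2pi mul1r.
Qed.

(** If the trace vanished identically, the Galois automorphisms would satisfy a linear relation with
    all coefficients 1, against their independence. *)
Lemma trFp_neq0 : exists y, trFp charFp y != 0.
Proof.
apply: contrapT => /forallNP h.
have H a : a \in {:L}%AS ->
    \sum_(x in 'Gal({:L} / 1%AS)%g) (fun=> 1 : L) x * x a = 0.
  move=> _; under eq_bigr do rewrite mul1r.
  have := trFpE charFp a; rewrite /galTrace => <-.
  by have /negP/negPn/eqP -> := h a; rewrite scale0r.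
have /eqP := gal_independent H (group1 _).
by rewrite oner_eq0.
Qed.

(** For 0 < t < p the half-angle pi t / p lies strictly between 0 and pi, so its sine is positive
    and the cosine of the full angle is below 1. *)
Lemma e_q_nontrivial : exists y, eq y != 1.
Proof.
have [y ty] := trFp_neq0; exists y.
set t := trFp charFp y in ty; pose th : R := 2 * pi * (t : nat)%:R / p%:R.
change (cis th != 1).
have p1 : (0 < p)%N by rewrite prime_gt0 ?p_prime.
have p0 : (0 < p%:R :> R) by rewrite ltr0n.
have h2 : th / 2 = pi * ((t : nat)%:R / p%:R) by rewrite /th; field; rewrite ?gt_eqF.
have tp : (t < p)%N by have := ltn_ord t; rewrite [X in (_ < X)%N](Fp_cast p_prime).
have s0 : 0 < sin (th / 2).
  have t0 : (0 < (t : nat))%N by rewrite lt0n.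
  rewrite h2; apply: sin_gt0_pi; rewrite mulr_gt0 ?divr_gt0 ?pi_gt0 ?ltr0n //=.
  by rewrite gtr_pMr ?pi_gt0 // ltr_pdivrMr // mul1r ltr_nat.
have thE : th = (th / 2) *+ 2 by rewrite -mulr_natr divfK // pnatr_eq0.
apply/eqP => -[+ _]; rewrite thE cos_mulr2n cos2sin2 => e1.
by have := exprn_gt0 2 s0; move: e1; rewrite -mulr_natl; lra.
Qed.

End AdditiveCharacter.

(** * Orthogonality relations for x -> e(x/g) *)

Section FractionCharacter.
Variables (R : realType) (F : finFieldType) (p : nat).
Variable charFp : p \in [pchar F].
Local Notation C := R[i].
Local Notation eq := (e_q R charFp).
Local Notation q := (#|F|%:R : C).

(** Translation by x0 preserves the sum but also multiplies it by [chi x0], which is not 1. *)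
Lemma char_sum_eq0 (V : finZmodType) (chi : V -> C) (x0 : V) :
  {morph chi : x y / x + y >-> x * y} -> chi x0 != 1 -> \sum_x chi x = 0.
Proof.
move=> chiM x01; have : (chi x0 - 1) * \sum_x chi x = 0.
  rewrite mulrBl mul1r mulr_sumr; apply/eqP; rewrite subr_eq0; apply/eqP.
  rewrite [RHS](reindex_inj (addrI x0)) /=.
  by apply: eq_bigr => x _; rewrite chiM.
by move/eqP; rewrite mulf_eq0 subr_eq0 (negPf x01) => /eqP.
Qed.

Lemma e_q0 : eq 0 = 1.
Proof.
have t0 : trFp charFp 0 = 0.
  by apply: (addrI (trFp charFp 0)); rewrite -trFpD !addr0.
by rewrite /e_q -/(cis _) t0 mulr0 mul0r cis0.
Qed.

Lemma sum_e_q : \sum_(x : F | x != 0) eq x = -1.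
Proof.
have [y y1] := e_q_nontrivial R charFp.
have := @char_sum_eq0 F _ _ (@e_qD R F p charFp) y1.
by rewrite (bigD1 0) //= e_q0 addrC => /eqP; rewrite addr_eq0 => /eqP.
Qed.

Variable g : {poly F}.
Hypothesis g_monic : g \is monic.
Hypothesis g_deg : (0 < deg g)%N.
Local Notation n := (deg g).

(* The coefficient of 1/T in x/g. *)
Definition residue (x : {poly F}) : F := ((x * 'X) %/ g)`_0.

Definition psi (x : {poly F}) : C := e_laurent R charFp (frac_laurent x g).

Lemma psiE x : psi x = eq (residue x).
Proof. by []. Qed.

Lemma residueD x y : residue (x + y) = residue x + residue y.
Proof. by rewrite /residue mulrDl divpD coefD. Qed.

Lemma residueZ t x : residue (t *: x) = t * residue x.
Proof. by rewrite /residue -scalerAl divpZl coefZ. Qed.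

Lemma residue_dvd x : g %| x -> residue x = 0.
Proof.
move=> /dvdpP[k ->]; rewrite /residue mulrAC mulpK ?monic_neq0 //.
by rewrite coefMX.
Qed.

(** The quotient of xT by g is a constant: subtracting x_(n-1) g from xT removes the coefficient of
    T^n. *)
Lemma residue_small (x : {poly F}) : (size x <= n)%N -> residue x = x`_n.-1.
Proof.
move=> sx; have sg := size_modulus g_monic.
have -> : residue x = (((x`_n.-1)%:P * g + (x * 'X - (x`_n.-1)%:P * g)) %/ g)`_0.
  by rewrite addrC subrK.
rewrite divp_addl_mul_small ?coefC // sg ltnS; apply/leq_sizeP => j.
rewrite leq_eqVlt coefB coefMX coefCM => /orP[/eqP<-|nj].
  have := monicP g_monic; rewrite /lead_coef sg => ->.
  by rewrite gtn_eqF // mulr1 subrr.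
rewrite [g`_j]nth_default ?sg // mulr0 subr0.
by case: j nj => //= j nj; rewrite nth_default // (leq_trans sx).
Qed.

Lemma psiD x y : psi (x + y) = psi x * psi y.
Proof. by rewrite !psiE residueD e_qD. Qed.

Lemma psi_periodic c : mod_periodic g (fun x => psi (c * x)).
Proof.
move=> x y gxy; rewrite !psiE -[c * x](subrK (c * y)) residueD -mulrBr.
by rewrite residue_dvd ?add0r // dvdp_mull.
Qed.

Lemma psi_sum_eq0 k b j : (j < k)%N -> residue ('X^j * b) != 0 ->
  \sum_(x : 'rV[F]_k) psi (rVpoly x * b) = 0.
Proof.
move=> jk rb; have [y y1] := e_q_nontrivial R charFp.
(* Scaled so that the residue of x0 b is y, on which [e_q] is not 1. *)
pose x0 : 'rV[F]_k := poly_rV ((y / residue ('X^j * b)) *: 'X^j).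
apply: (char_sum_eq0 (x0 := x0)) => [x z|]; first by rewrite linearD mulrDl psiD.
rewrite poly_rV_K; last by rewrite (leq_trans (size_scale_leq _ _)) ?size_polyXn.
by rewrite -scalerAl psiE residueZ divfK.
Qed.

Lemma monic_sum_psi_eq0 k b j : (j < k)%N -> residue ('X^j * b) != 0 ->
  monic_sum k (fun a => psi (a * b)) = 0.
Proof.
move=> jk rb; rewrite /monic_sum.
under eq_bigr do rewrite mulrDl psiD.
by rewrite -mulr_sumr (psi_sum_eq0 jk rb) mulr0.
Qed.

Lemma psi_sum_full k b : (forall j, (j < k)%N -> residue ('X^j * b) = 0) ->
  \sum_(x : 'rV[F]_k) psi (rVpoly x * b) = q ^+ k.
Proof.
move=> rb; rewrite -natrX -card_rV -sumr_const; apply: eq_bigr => x _.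
rewrite psiE [X in residue (X * _)]/rVpoly poly_def mulr_suml.
rewrite (_ : residue _ = 0) ?e_q0 //.
rewrite (big_morph residue residueD (residue_dvd (dvdp0 g))) big1 // => j _.
by rewrite -scalerAl residueZ rb ?mulr0.
Qed.

Lemma monic_sum_psi_full k b : (forall j, (j < k)%N -> residue ('X^j * b) = 0) ->
  monic_sum k (fun a => psi (a * b)) = q ^+ k * psi ('X^k * b).
Proof.
move=> rb; rewrite /monic_sum.
under eq_bigr do rewrite mulrDl psiD.
by rewrite -mulr_sumr psi_sum_full // mulrC.
Qed.

Lemma residue_shift (b : {poly F}) j : (size b <= n)%N -> (j + size b <= n)%N ->
  residue ('X^j * b) = if (j + size b == n)%N then lead_coef b else 0.
Proof.
move=> sb jb; have [->|b0] := eqVneq b 0.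
  by rewrite mulr0 residue_dvd ?dvdp0 // lead_coef0 if_same.
have s1 : size ('X^j * b) = (j + size b)%N by rewrite mulrC size_mulXn.
rewrite residue_small ?s1 // mulrC coefMXn.
have b1 : (0 < size b)%N by rewrite size_poly_gt0.
case: eqP => [e|/eqP ne].
  by rewrite ifF; [rewrite /lead_coef; congr (_`_ _) |]; lia.
have jb1 : (j + size b < n)%N by rewrite ltn_neqAle ne.
case: ifP => // jn; rewrite nth_default //.
move: jb1 g_deg; clear; move: (size b) (deg g) => s m. lia.
Qed.

(** The first power of T whose product with b has a nonzero residue is T^(n - size b), and that
    residue is the leading coefficient of b. The character is thus trivial on the lower coefficients
    exactly when k does not exceed this exponent; at equality the leading term T^k alone contributes
    a factor. *)
Lemma monic_sum_psi k (b : {poly F}) : (size b <= n)%N -> (k < n)%N ->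
  monic_sum k (fun a => psi (a * b)) =
  if (k + size b < n)%N then q ^+ k
  else if (k + size b == n)%N then q ^+ k * eq (lead_coef b) else 0.
Proof.
move=> sb kn; case: ltnP => kb.
  rewrite monic_sum_psi_full => [|j jk].
    by rewrite psiE (residue_shift sb (ltnW kb)) (ltn_eqF kb) e_q0 mulr1.
  by rewrite residue_shift ?ifF //; lia.
case: eqP => [e|/eqP ne].
  rewrite monic_sum_psi_full => [|j jk].
    by rewrite psiE residue_shift ?e ?eqxx.
  by rewrite residue_shift ?ifF //; lia.
apply: (@monic_sum_psi_eq0 _ _ (n - size b)%N); first by lia.
rewrite residue_shift ?subnK // eqxx lead_coef_eq0 -size_poly_gt0.
lia.
Qed.

(** If x is nonzero modulo g, multiplying its residue by a power of T moves the leading coefficient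
    to position n - 1, so the character is nontrivial. *)
Lemma residue_sum_psi x :
  residue_sum n (fun a => psi (a * x)) = if g %| x then q ^+ n else 0.
Proof.
transitivity (residue_sum n (fun a => psi (a * (x %% g)))).
  apply: eq_bigr => a _; apply: psi_periodic.
  by rewrite dvdp_sub_mod modp_id.
have sx := size_mod g_monic x; rewrite /residue_sum /dvdp.
have [->|x0] := eqVneq (x %% g) 0.
  by apply: psi_sum_full => j _; rewrite mulr0 residue_dvd ?dvdp0.
rewrite -size_poly_gt0 in x0; rewrite /=.
apply: (@psi_sum_eq0 _ _ (n - size (x %% g)%R)%N); first by lia.
by rewrite residue_shift ?subnK // eqxx lead_coef_eq0 -size_poly_gt0.
Qed.

End FractionCharacter.

(** * The functional equation of the rational functions *)

Section Hurwitz.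
Variables (R : realType) (F : finFieldType) (p : nat).
Variable charFp : p \in [pchar F].
Variable g : {poly F}.
Hypothesis g_monic : g \is monic.
Hypothesis g_deg : (0 < deg g)%N.
Local Notation C := R[i].
Local Notation eq := (e_q R charFp).
Local Notation q := (#|F|%:R : C).
Local Notation n := (deg g).
Local Notation psi := (psi R charFp g).

(* The sum of u^(deg f) over the monic f congruent to x modulo g. *)
Definition zeta (u : C) (x : {poly F}) : C :=
  u ^+ n / (1 - q * u) + (x %% g \is monic)%:R * u ^+ deg (x %% g).

(* The sum of e(fx/g) u^(deg f) over the monic f. *)
Definition zetahat (u : C) (x : {poly F}) : C :=
  residue_sum n (fun a => psi (a * x) * zeta u a).

Lemma zeta_periodic u : mod_periodic g (zeta u).
Proof. by move=> x y; rewrite dvdp_sub_mod // /zeta => /eqP ->. Qed.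

Lemma zetahat_periodic u : mod_periodic g (zetahat u).
Proof.
move=> x y gxy; apply: eq_bigr => a _; congr (_ * _); exact: psi_periodic.
Qed.

Lemma sum_monic_weighted m (w : nat -> C) phi :
  \sum_(y : 'rV[F]_m) phi (rVpoly y) * ((rVpoly y \is monic)%:R * w (deg (rVpoly y))) =
  \sum_(k < m) w k * monic_sum k phi.
Proof.
under [RHS]eq_bigr => k _ do rewrite -(sum_monic_deg (m := m)) //.
under [RHS]eq_bigr => k _ do rewrite mulr_sumr big_mkcond.
rewrite exchange_big; apply: eq_bigr => y _ /=.
have [ym|_] := boolP (rVpoly y \is monic); last first.
  by rewrite mul0r mulr0 big1.
have dm : (deg (rVpoly y) < m)%N.
  have := size_poly m (fun k => if insub k is Some i then y 0 i else 0).
  rewrite -/(rVpoly y) /deg; have := monic_neq0 ym; rewrite -size_poly_gt0.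
  by case: (size _).
rewrite (bigD1 (Ordinal dm)) //= eqxx big1 ?addr0 ?mul1r 1?mulrC // => k.
by rewrite -val_eqE /= eq_sym => /negPf ->.
Qed.

(** The part of [zeta] common to all classes sums by orthogonality; the other part is supported on
    reduced monic polynomials and is grouped by degree. *)
Lemma zetahatE u x : zetahat u x =
  \sum_(k < n) u ^+ k * monic_sum k (fun a => psi (a * x)) +
  (if g %| x then q ^+ n else 0) * (u ^+ n / (1 - q * u)).
Proof.
rewrite -(residue_sum_psi R charFp) // -(sum_monic_weighted _ (fun k => u ^+ k)) addrC.
rewrite /zetahat /residue_sum mulr_suml -big_split; apply: eq_bigr => a _.
rewrite /= -mulrDr /zeta mod_rVpoly //.
Qed.

Lemma geometric_sum (y : C) m : y != 1 ->
  \sum_(k < m) y ^+ k = (1 - y ^+ m) / (1 - y).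
Proof.
move=> y1; apply: (mulIf (x := 1 - y)); first by rewrite subr_eq0 eq_sym.
rewrite divfK ?subr_eq0 1?eq_sym //.
by rewrite -[in RHS](expr1n _ m) subrXX mulrC; congr (_ * _);
   apply: eq_bigr => k _; rewrite expr1n mul1r.
Qed.

(** For nonzero b the degree sums form a geometric progression that stops at m = n - size b, its
    last term twisted by the leading coefficient. For b = 0 the finite progression and the tail make
    up the full geometric series. *)
Lemma zetahat_closed u (b : {poly F}) : (size b <= n)%N -> q * u != 1 ->
  zetahat u b = (1 - q * u)^-1 + (if b == 0 then 0 else
    (q * u) ^+ (n - size b) * (eq (lead_coef b) - (1 - q * u)^-1)).
Proof.
move=> sb qu1.
have qu1' : 1 - q * u != 0 by rewrite subr_eq0 eq_sym.
rewrite zetahatE.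
under eq_bigr => k _ do rewrite monic_sum_psi //.
have dvdb : (g %| b) = (b == 0).
  by rewrite /dvdp modp_small // (size_modulus g_monic) ltnS.
have [->|b0] := eqVneq b 0.
  rewrite dvdp0 addr0.
  under eq_bigr => k _ do rewrite size_poly0 addn0 ltn_ord mulrC -exprMn.
  rewrite geometric_sum // exprMn; field; exact: qu1'.
rewrite dvdb (negPf b0) mul0r addr0.
have b1 : (0 < size b)%N by rewrite size_poly_gt0.
set m := (n - size b)%N.
have mn : (m.+1 <= n)%N by rewrite /m; lia.
pose G k := if (k < m)%N then (q * u) ^+ k
  else if k == m then (q * u) ^+ k * eq (lead_coef b) else 0.
rewrite (eq_bigr (fun k : 'I_n => if (k < m.+1)%N then G k else 0)); last first.
  move=> k _; case: (ltngtP (k + size b) n) => kb.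
  - have km : (k < m)%N by rewrite /m; lia.
    by rewrite ltnS (ltnW km) /G km mulrC exprMn.
  - have mk : (m < k)%N by rewrite /m; have := ltn_ord k; lia.
    by rewrite mulr0 ltnS leqNgt mk.
  - have -> : nat_of_ord k = m by rewrite /m; lia.
    by rewrite ltnS leqnn /G ltnn eqxx mulrA -exprMn [u * q]mulrC.
rewrite -big_mkcond -(big_ord_widen n G mn) big_ord_recr /=.
rewrite (eq_bigr (fun k : 'I_m => (q * u) ^+ k)); last first.
  by move=> k _; rewrite /G ltn_ord.
rewrite geometric_sum // /G ltnn eqxx; field; exact: qu1'.
Qed.

(** The coefficient of the power of qu in the closed form of [zetahat]; products of two weights,
    averaged against chi, give [calB]. *)
Definition weight (u : C) (lambda : F) : C := eq lambda - (1 - q * u)^-1.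

Lemma sum_weight u : q * u != 1 ->
  \sum_(lambda : F | lambda != 0) weight u lambda = - (q * (1 - u)) / (1 - q * u).
Proof.
move=> qu1; have qu1' : 1 - q * u != 0 by rewrite subr_eq0 eq_sym.
rewrite sumrB sum_e_q sumr_const.
have -> : #|[pred x : F | x != 0]| = #|F|.-1 by rewrite -(cardC1 (0 : F)).
have -> : (1 - q * u)^-1 *+ #|F|.-1 = (1 - q * u)^-1 * (q - 1).
  have F0 : (0 < #|F|)%N by apply/card_gt0P; exists 0.
  by rewrite -[X in X%:R](prednK F0) -natr1 addrK mulr_natr.
field; exact: qu1'.
Qed.

(** Among the multiples of x by 1/lambda only the one with lambda the leading coefficient of the
    reduced x is monic, so the sum selects the right weight. The common parts add up to 1/(1 - qu)
    by [sum_weight]; here u != 1 keeps 1/(qu) off the pole 1/q. *)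
Lemma zetahat_Hurwitz u x : u != 0 -> u != 1 -> q * u != 1 ->
  zetahat u x = (q * u) ^+ n.-1 *
    \sum_(lambda : F | lambda != 0)
      weight u lambda * zeta (q * u)^-1 (lambda^-1 *: x).
Proof.
move=> u0 u1 qu1; have qu1' : 1 - q * u != 0 by rewrite subr_eq0 eq_sym.
have u1' : u - 1 != 0 by rewrite subr_eq0.
have q0 := q_neq0 F C.
have -> : zetahat u x = zetahat u (x %% g).
  by apply: zetahat_periodic; rewrite dvdp_sub_mod // modp_id.
have sb := size_mod g_monic x.
rewrite zetahat_closed //; set b := x %% g in sb *.
set v := (q * u)^-1.
have qu0 : q * u != 0 by rewrite mulf_neq0.
have zE lambda : lambda != 0 -> zeta v (lambda^-1 *: x) =
    v ^+ n / (1 - q * v) + (lead_coef b == lambda)%:R * v ^+ (size b).-1.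
  move=> l0; rewrite /zeta modpZl -/b /deg size_scale ?invr_eq0 //.
  rewrite monicE lead_coefZ; congr (_ + _%:R * _).
  by rewrite -(inj_eq (mulfI l0)) mulVKf // mulr1.
rewrite (eq_bigr (fun lambda => weight u lambda * (v ^+ n / (1 - q * v)) +
   (if lead_coef b == lambda then weight u lambda * v ^+ (size b).-1 else 0))); last first.
  move=> l l0; rewrite zE // mulrDr; congr (_ + _).
  by case: eqP; rewrite ?mul1r ?mul0r ?mulr0.
rewrite big_split /= -mulr_suml sum_weight // (mulrDr ((q * u) ^+ n.-1)); congr (_ + _).
  have -> : (q * u) ^+ n.-1 * (- (q * (1 - u)) / (1 - q * u) * (v ^+ n / (1 - q * v))) =
    ((q * u) ^+ n.-1 * v ^+ n) * (- (q * (1 - u)) / (1 - q * u) / (1 - q * v)) by ring.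
  have -> : (q * u) ^+ n.-1 * v ^+ n = v.
    rewrite -[X in v ^+ X](prednK g_deg) exprS mulrCA -exprMn mulfV //.
    by rewrite expr1n mulr1.
  by rewrite /v; field; rewrite qu1' u0 q0 u1'.
have [b0|b0] := eqVneq b 0.
  rewrite big1 ?mulr0 // => l l0.
  by rewrite b0 lead_coef0 eq_sym (negPf l0).
rewrite (bigD1 (lead_coef b)) ?lead_coef_eq0 //= eqxx big1 ?addr0; last first.
  by move=> l /andP[_]; rewrite eq_sym => /negPf ->.
rewrite -/(weight u _) mulrCA [LHS]mulrC; congr (_ * _).
rewrite /v exprVn; rewrite -size_poly_gt0 in b0.
have -> : n.-1 = ((n - size b) + (size b).-1)%N by lia.
by rewrite exprD mulfK // expf_neq0.
Qed.

(** Fourier inversion on F[T]/(g): after exchanging the sums, orthogonality keeps only the class of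
    x. *)
Lemma zeta_inversion u x :
  zeta u x = q ^- n * residue_sum n (fun b => zetahat u b * psi (- (x * b))).
Proof.
rewrite /zetahat /residue_sum.
under eq_bigr do rewrite mulr_suml.
rewrite exchange_big /=.
transitivity (q ^- n * \sum_(a : 'rV[F]_n) zeta u (rVpoly a) *
   residue_sum n (fun b => psi (b * (rVpoly a - x)))); last first.
  congr (_ * _); apply: eq_bigr => a _; rewrite mulr_sumr; apply: eq_bigr => b _.
  by rewrite [LHS]mulrC mulrAC -psiD; congr (psi _ * _); ring.
rewrite (bigD1 (poly_rV (x %% g))) //= rVpoly_modK //.
rewrite [X in _ * (_ + X)]big1 => [|a ax].
  rewrite addr0 residue_sum_psi // dvdp_sub_mod // modp_id eqxx.
  by rewrite mulrCA mulVf ?mulr1 ?expf_neq0 ?q_neq0 // periodic_mod //; exact: zeta_periodic.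
rewrite residue_sum_psi // dvdp_sub_mod // mod_rVpoly // ifF ?mulr0 //.
apply: contraNF ax => /eqP <-; by rewrite rVpolyK.
Qed.

End Hurwitz.

(** * Functional equation of the Estermann function away from u = 0, 1, 1/q *)

Section FunctionalEquation.
Variables (R : realType) (F : finFieldType) (p : nat).
Variable charFp : p \in [pchar F].
Variables g l : {poly F}.
Hypothesis g_monic : g \is monic.
Hypothesis g_deg : (0 < deg g)%N.
Hypothesis l_dvd_g : l %| g.
Variable chi : {poly F} -> R[i].
Hypothesis chiP : dirichlet_character l chi.
Local Notation C := R[i].
Local Notation eq := (e_q R charFp).
Local Notation q := (#|F|%:R : C).
Local Notation n := (deg g).
Local Notation psi := (psi R charFp g).
Local Notation zeta := (@zeta R F g).
Local Notation zetahat := (zetahat charFp g).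
Local Notation weight := (weight charFp).

Lemma chi1 : chi 1 = 1. Proof. by case: chiP. Qed.
Lemma chiM x y : chi (x * y) = chi x * chi y. Proof. by case: chiP. Qed.

Lemma chiN x : chi (- x) = chi (- 1) * chi x.
Proof. by rewrite -chiM mulN1r. Qed.

Lemma chi_periodic : mod_periodic g chi.
Proof.
by case: chiP => _ _ per _ x y gxy; apply: per; exact: dvdp_trans gxy.
Qed.

(* The value at u of the meromorphic continuation, for qu != 1. *)
Definition estermann (c : {poly F}) (u : C) : C :=
  residue_sum n (fun a => chi a * zeta u a * zetahat u (c * a)).

(** Fourier inversion of [zetahat_Hurwitz]. *)
Lemma zeta_Hurwitz u x : u != 0 -> u != 1 -> q * u != 1 ->
  zeta u x = q^-1 * u ^+ n.-1 *
    \sum_(lambda : F | lambda != 0)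
      weight u lambda * zetahat (q * u)^-1 (- lambda *: x).
Proof.
move=> u0 u1 qu1; rewrite (zeta_inversion charFp g_monic g_deg).
set v := (q * u)^-1.
(* Rescaling b by lambda turns the inversion sum back into a Fourier transform, now at 1/(qu). *)
have twist lambda : lambda != 0 ->
    residue_sum n (fun b => zeta v (lambda^-1 *: b) * psi (- (x * b))) =
    zetahat v (- lambda *: x).
  move=> l0; rewrite /zetahat.
  rewrite -[RHS](residue_sum_mul (c := lambda^-1%:P) g_monic).
  - apply: eq_bigr => b _; rewrite mul_polyC [RHS]mulrC; congr (_ * psi _).
    by rewrite -scalerAl -scalerAr scalerA mulrN mulVf // scaleN1r mulrC.
  - by move=> y z gyz; rewrite (zeta_periodic v gyz) !(mulrC _ (- lambda *: x));
       rewrite (psi_periodic R charFp g_monic _ gyz).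
  - by rewrite coprimep_sym -alg_polyC coprimepZr ?coprimep1 // invr_eq0.
have q0 := q_neq0 F C.
have -> : q^-1 * u ^+ n.-1 = q ^- n * (q * u) ^+ n.-1.
  rewrite exprMn mulrA; congr (_ * _).
  by rewrite -[X in q ^- X](prednK g_deg) exprS invfM mulfVK ?expf_neq0.
rewrite -mulrA; congr (_ * _); rewrite mulr_sumr.
under [RHS]eq_bigr => lambda l0 do rewrite -twist // /residue_sum !mulr_sumr.
rewrite exchange_big; apply: eq_bigr => b _ /=.
rewrite zetahat_Hurwitz // -[LHS]mulrA mulr_suml mulr_sumr.
apply: eq_bigr => lambda _; rewrite -/v; ring.
Qed.

(** Substitute a -> mu cbar a: it clears mu and c from the argument of [zeta], carries cbar into
    that of [zetahat], and chi splits off its values at mu and cbar. *)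
Lemma estermann_sub (c cbar : {poly F}) (lambda mu : F) v :
  coprimep cbar g -> g %| c * cbar - 1 -> mu != 0 ->
  residue_sum n (fun a => chi a * zetahat v (- lambda *: a) *
    zeta v (mu^-1 *: (c * a))) =
  chi mu%:P * chi cbar * estermann (- (lambda * mu) *: cbar) v.
Proof.
move=> cb ccb mu0; pose h := mu *: cbar.
have zE b : zeta v (mu^-1 *: (c * (h * b))) = zeta v b.
  apply: zeta_periodic; rewrite /h -scalerAl -scalerAr scalerA mulVf // scale1r.
  by rewrite mulrA -[X in _ - X]mul1r -mulrBl dvdp_mulr.
rewrite -(residue_sum_mul (c := h) g_monic).
- rewrite /estermann /residue_sum mulr_sumr; apply: eq_bigr => b _.
  rewrite zE !chiM /h -mul_polyC chiM [LHS]mulrAC !mulrA; congr (_ * zetahat _ _).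
  by rewrite mul_polyC -!scalerAl scalerA mulNr.
- move=> y z gyz; rewrite (chi_periodic gyz); congr (_ * _ * _).
    by apply: zetahat_periodic => //; rewrite -scalerBr -mul_polyC dvdp_mull.
  by apply: zeta_periodic; rewrite -scalerBr -mulrBr -mul_polyC !dvdp_mull.
- by rewrite coprimepZl.
Qed.

(** Multiplication by a permutes the classes, hence fixes the sum of |chi|, which is nonzero because
    of the class of 1; yet it scales that sum by |chi(a)|. *)
Lemma norm_chi a : coprimep a g -> `|chi a| = 1.
Proof.
move=> ag; pose S := residue_sum n (fun x => `|chi x|).
have S0 : S != 0.
  apply/negP => /eqP /psumr_eq0P S0.
  have /(_ (poly_rV 1)) := S0 (fun _ _ => normr_ge0 _).
  rewrite poly_rV_K ?size_poly1 // chi1 normr1 => /(_ isT)/eqP.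
  by rewrite oner_eq0.
have per : mod_periodic g (fun x => `|chi x|) by move=> x y /chi_periodic ->.
have := residue_sum_mul g_monic per ag.
rewrite /residue_sum; under eq_bigr do rewrite chiM normrM.
rewrite -mulr_sumr -/(residue_sum n (fun x => `|chi x|)) -/S -[RHS]mul1r.
exact: mulIf.
Qed.

(** On the unit circle conjugation is inversion, and chi(-1) is its own inverse. *)
Lemma conj_chi (c cbar : {poly F}) : coprimep c g -> g %| c * cbar - 1 ->
  (chi (- c))^* = chi (- 1) * chi cbar.
Proof.
move=> cg ccb.
have chiNN : chi (- 1) * chi (- 1) = 1 by rewrite -chiN opprK chi1.
have e : chi (- c) * (chi (- 1) * chi cbar) = 1.
  by rewrite chiN mulrACA chiNN mul1r -chiM -chi1; exact: chi_periodic.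
have N : `|chi (- c)| = 1 by apply: norm_chi; rewrite -scaleN1r coprimepZl // oppr_eq0 oner_eq0.
have n0 : chi (- c) != 0 by rewrite -normr_eq0 N oner_eq0.
by apply: (mulfI n0); rewrite -normCK N expr1n e.
Qed.

(** Multiplying out the two weights gives four terms; an index 1 replaces an additive character by
    the constant 1/(1 - qu). Each term is a Kloosterman sum after mu -> -mu, whence the factor
    chi(-1). *)
Lemma calBE lambda u : q * u != 1 -> lambda != 0 ->
  calB charFp chi lambda u = q^-1 * chi (-1) *
    \sum_(mu : F | mu != 0) chi mu%:P * weight u mu * weight u (- (lambda / mu)).
Proof.
move=> qu1 l0; have qu1' : 1 - q * u != 0 by rewrite subr_eq0 eq_sym.
have q0 := q_neq0 F C.
pose S (e1 e2 : nat) := \sum_(mu : F | mu != 0)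
  chi mu%:P * eq ((1 - e1%:R) * mu) * eq ((1 - e2%:R) * - (lambda / mu)).
have KlE (e1 e2 : nat) :
    Kl charFp chi (e1%:R - 1) ((1 - e2%:R) * lambda) = chi (-1) * S e1 e2.
  rewrite mulr_sumr /Kl (reindex_inj oppr_inj) /=; apply: eq_big => [x|x _].
    by rewrite oppr_eq0.
  rewrite polyCN chiN -!mulrA; congr (_ * (_ * _)).
  by rewrite -e_qD invrN; congr eq; ring.
rewrite /calB; under eq_bigr do under eq_bigr do rewrite KlE.
rewrite !big_ord_recl !big_ord0 /=; set t := (1 - q * u)^-1.
have -> : \sum_(mu | mu != 0) chi mu%:P * weight u mu * weight u (- (lambda / mu)) =
    S 0%N 0%N - t * S 1%N 0%N - t * S 0%N 1%N + t * t * S 1%N 1%N.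
  rewrite /S !mulr_sumr -!sumrN -!big_split; apply: eq_bigr => mu _ /=.
  by rewrite !subr0 !subrr !mul1r !mul0r !e_q0 /weight -/t; ring.
rewrite /bump /= /t; field.
by rewrite qu1'.
Qed.

Lemma estermann_functional (c cbar : {poly F}) u :
  coprimep c g -> g %| c * cbar - 1 -> u != 0 -> u != 1 -> q * u != 1 ->
  estermann c u = (chi (- c))^* * (q * u ^+ 2) ^+ n.-1 *
    \sum_(lambda : F | lambda != 0)
      calB charFp chi lambda u * estermann (lambda *: cbar) (q * u)^-1.
Proof.
move=> cg ccb u0 u1 qu1; set v := (q * u)^-1.
have cbg : coprimep cbar g.
  case/dvdpP: ccb => k ek; apply/Bezout_coprimepP; exists (c, - k) => /=.
  by rewrite mulNr -ek opprB addrC subrK eqpxx.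
(* Both Hurwitz formulas inserted, and the sum over a evaluated by [estermann_sub]. *)
transitivity (q^-1 * (q * u ^+ 2) ^+ n.-1 *
  \sum_(lambda : F | lambda != 0) \sum_(mu : F | mu != 0)
    weight u lambda * weight u mu *
    (chi mu%:P * chi cbar * estermann (- (lambda * mu) *: cbar) v)).
  under eq_bigr => lambda l0.
    under eq_bigr => mu m0.
      rewrite -(estermann_sub lambda v cbg ccb m0) /residue_sum mulr_sumr.
      over.
    over.
  under eq_bigr => lambda l0 do rewrite exchange_big /=.
  rewrite exchange_big /= /estermann /residue_sum mulr_sumr; apply: eq_bigr => a _.
  rewrite zeta_Hurwitz // zetahat_Hurwitz // -/v.
  have -> : (q * u ^+ 2) ^+ n.-1 = u ^+ n.-1 * (q * u) ^+ n.-1.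
    by rewrite -exprMn; congr (_ ^+ _); ring.
  set S1 := \sum_(lambda | _) _; set S2 := \sum_(lambda | _) _.
  transitivity (q^-1 * (u ^+ n.-1 * (q * u) ^+ n.-1) * (chi (rVpoly a) * (S1 * S2))).
    ring.
  congr (_ * _); rewrite big_distrlr /= mulr_sumr; apply: eq_bigr => lambda l0.
  rewrite mulr_sumr; apply: eq_bigr => mu m0; ring.
rewrite (conj_chi cg ccb).
have chiNN : chi (- 1) * chi (- 1) = 1 by rewrite -chiM mulrNN mulr1 chi1.
have q0 := q_neq0 F C.
rewrite exchange_big /=.
under [in RHS]eq_bigr => nu n0 do rewrite calBE // [X in X * _]mulr_sumr mulr_suml.
rewrite [in RHS]exchange_big !mulr_sumr; apply: eq_bigr => mu m0 /=.
(* For fixed mu, the variable nu = - lambda mu is the one by which cbar gets multiplied. *)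
rewrite (reindex_inj (h := fun nu => - (nu / mu))) /=; last first.
  by move=> x y /oppr_inj /(mulIf _); apply; rewrite invr_eq0.
rewrite (eq_bigl (fun nu => nu != 0)) => [|nu]; last first.
  by rewrite oppr_eq0 mulf_eq0 invr_eq0 (negPf m0) orbF.
rewrite !mulr_sumr; apply: eq_bigr => nu _.
rewrite mulNr divfK // opprK.
(* One factor chi(-1) stems from the conjugate of chi(-c), the other from [calBE]; they cancel. *)
transitivity (chi (-1) * chi (-1) * (q^-1 * (q * u ^+ 2) ^+ n.-1 *
  (weight u (- (nu / mu)) * weight u mu *
    (chi mu%:P * chi cbar * estermann (nu *: cbar) v)))).
  by rewrite chiNN mul1r.
ring.
Qed.

End FunctionalEquation.

(** * Division by 1 - theta X on coefficient sequences *)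

Section GeometricConvolution.
Variable K : comNzRingType.

(* Coefficients of (\sum_i s_i X^i) / (1 - theta X). *)
Definition geo_conv (theta : K) (s : nat -> K) (N : nat) : K :=
  \sum_(i < N.+1) theta ^+ (N - i) * s i.

(** Up to degree N a truncated geometric series serves as the inverse of 1 - theta X, so identities
    of series reduce to ring identities of polynomials. *)
Lemma geo_convE theta (A : {poly K}) M N : (N < M)%N ->
  geo_conv theta (fun i => A`_i) N = (\poly_(i < M) theta ^+ i * A)`_N.
Proof.
move=> NM; rewrite coefMr; apply: eq_bigr => i _.
by rewrite coef_poly (leq_ltn_trans (leq_subr _ _) NM).
Qed.

Lemma geo_conv_ext theta s t N : (forall i, (i <= N)%N -> s i = t i) ->
  geo_conv theta s N = geo_conv theta t N.
Proof. by move=> st; apply: eq_bigr => i _; rewrite st // -ltnS. Qed.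

(** Cauchy product: A/(1 - theta X) times B/(1 - theta X) is AB/(1 - theta X)^2. *)
Lemma geo_conv_mul theta (A B : {poly K}) N :
  \sum_(i < N.+1) geo_conv theta (fun j => A`_j) i *
                  geo_conv theta (fun j => B`_j) (N - i) =
  geo_conv theta (geo_conv theta (fun j => (A * B)`_j)) N.
Proof.
pose G := \poly_(i < N.+1) theta ^+ i.
transitivity ((G * A * (G * B))`_N).
  rewrite coefM; apply: eq_bigr => i _.
  by rewrite !(geo_convE _ _ (M := N.+1)) // ltnS leq_subr.
rewrite (_ : G * A * (G * B) = G * (G * (A * B))); last by ring.
rewrite -geo_convE //; apply: geo_conv_ext => i iN.
by rewrite (geo_convE _ _ (M := N.+1)).
Qed.

Lemma geo_conv_linear (I : finType) theta (k : I -> K) (s : I -> nat -> K) N :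
  geo_conv theta (fun j => \sum_i k i * s i j) N =
  \sum_i k i * geo_conv theta (s i) N.
Proof.
under [RHS]eq_bigr do rewrite mulr_sumr.
rewrite exchange_big; apply: eq_bigr => j _; rewrite mulr_sumr.
by apply: eq_bigr => i _; rewrite mulrCA.
Qed.

Lemma geo_conv_telescope theta (A : {poly K}) n N :
  geo_conv theta (fun i => ((1 - theta%:P * 'X) * A + 'X^n)`_i) N =
  A`_N + (if (n <= N)%N then theta ^+ (N - n) else 0).
Proof.
rewrite (geo_convE _ _ (M := N.+1)) // mulrDr mulrA coefD; congr (_ + _).
  have -> : \poly_(i < N.+1) theta ^+ i * (1 - theta%:P * 'X) =
      1 - (theta ^+ N.+1)%:P * 'X^(N.+1).
    rewrite poly_def; under eq_bigr do rewrite -mul_polyC rmorphXn -exprMn.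
    rewrite rmorphXn -exprMn -[in RHS](expr1n _ N.+1) subrXX mulrC.
    by congr (_ * _); apply: eq_bigr => i _; rewrite expr1n mul1r.
  by rewrite mulrBl mul1r coefB mulrAC coefMXn ltnSn subr0.
rewrite coefMXn ltnNge; case: leqP => //= nN.
by rewrite coef_poly ltnS leq_subr.
Qed.

End GeometricConvolution.

(** Transfers sums over classical sets of polynomials to sums over a finite type that parametrizes
    them. *)
Lemma fsum_fintype (V : nmodType) (T : finType) (I : choiceType) (h : T -> I)
    (P : pred T) (A : set I) (f : I -> V) :
  injective h -> (forall i, A i <-> exists2 t, P t & h t = i) ->
  \sum_(i \in A) f i = \sum_(t | P t) f (h t).
Proof.
move=> hinj AP; rewrite (@fsbigE _ _ _ _ _ [seq h t | t <- enum P]) /=.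
- rewrite big_map big_enum_cond; apply: eq_bigl => t.
  rewrite unfold_in; have [Pt|_] /= := boolP (P t); last by [].
  by apply: mem_set; apply/AP; exists t.
- by rewrite map_inj_uniq // enum_uniq.
- by move=> i /= /mapP[t]; rewrite mem_enum => Pt ->; apply/AP; exists t.
- by move=> i /AP[t Pt <-] /negP[]; rewrite map_f // mem_enum.
Qed.

(** * Rationality of the generating series of the coefficients *)

Section Coefficients.
Variables (R : realType) (F : finFieldType) (p : nat).
Variable charFp : p \in [pchar F].
Variables g l : {poly F}.
Hypothesis g_monic : g \is monic.
Hypothesis g_deg : (0 < deg g)%N.
Hypothesis l_dvd_g : l %| g.
Variable chi : {poly F} -> R[i].
Hypothesis chiP : dirichlet_character l chi.
Local Notation C := R[i].
Local Notation q := (#|F|%:R : C).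
Local Notation n := (deg g).
Local Notation psi := (psi R charFp g).

Lemma r_chiE N (f : {poly F}) : f \is monic -> (size f <= N)%N ->
  r_chi chi f = \sum_(y : 'rV[F]_N | (rVpoly y \is monic) && (rVpoly y %| f))
    chi (rVpoly y).
Proof.
move=> fm sf; apply: fsum_fintype => [|d].
  exact: (can_inj (@rVpolyK _ _)).
split=> [[dm df]|[y /andP[ym yf] <-]] //.
have sd : (size d <= N)%N by rewrite (leq_trans _ sf) // dvdp_leq // monic_neq0.
by exists (poly_rV d); rewrite ?poly_rV_K // dm.
Qed.

Lemma fsum_monic N (h : {poly F} -> C) :
  \sum_(f \in [set f : {poly F} | f \is monic /\ deg f = N]) h f = monic_sum N h.
Proof.
apply: (fsum_fintype (h := fun x : 'rV[F]_N => 'X^N + rVpoly x)) => [x y|f].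
  by move=> /addrI; exact: (can_inj (@rVpolyK _ _)).
split=> [[fm /eqP]|[x _ <-]]; last first.
  by split; [exact: monic_rV | apply/eqP; rewrite degE ?monic_rV // size_monic_rV].
rewrite degE // => /eqP sf; exists (poly_rV (f - 'X^N)) => //.
by rewrite poly_rV_K ?size_sub_monic // addrC subrK.
Qed.

(** Reindexing by z -> yz, whose inverse is exact division by y. *)
Lemma monic_sum_dvd N (y : {poly F}) (h : {poly F} -> C) :
  y \is monic -> (deg y <= N)%N ->
  \sum_(x : 'rV[F]_N.+1 | (rVpoly x \is monic) && (deg (rVpoly x) == N) && (y %| rVpoly x))
    h (rVpoly x) = monic_sum (N - deg y) (fun z => h (y * z)).
Proof.
move=> ym yN; have y0 := monic_neq0 ym.
have sy : size y = (deg y).+1 by rewrite /deg prednK // size_poly_gt0.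
have sm (z : 'rV[F]_(N - deg y)) : size (y * ('X^(N - deg y) + rVpoly z)) = N.+1.
  rewrite (size_monicM ym) ?monic_neq0 ?monic_rV // size_monic_rV sy addSn /=.
  by rewrite addnS subnKC.
pose hz (z : 'rV[F]_(N - deg y)) : 'rV[F]_N.+1 :=
  poly_rV (y * ('X^(N - deg y) + rVpoly z)).
have hK z : rVpoly (hz z) = y * ('X^(N - deg y) + rVpoly z).
  by rewrite poly_rV_K // sm.
rewrite (reindex_onto hz (fun x => poly_rV (rVpoly x %/ y - 'X^(N - deg y)))) /=.
  apply: eq_big => z; last by rewrite hK.
  rewrite hK dvdp_mulr // andbT monicMl ?monic_rV // degE ?monicMl ?monic_rV //.
  by rewrite sm eqxx mulrC mulpK // addrC addKr rVpolyK eqxx.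
move=> x /andP[/andP[xm xN] yx].
have xq : rVpoly x = (rVpoly x %/ y) * y by rewrite divpK.
have qm : rVpoly x %/ y \is monic by move: xm; rewrite {1}xq monicMr.
rewrite degE // in xN.
have sq : size (rVpoly x %/ y) = (N - deg y).+1.
  by rewrite size_divp // (eqP xN) sy /= subSn.
by rewrite /hz poly_rV_K ?size_sub_monic // addrC subrK mulrC divpK // rVpolyK.
Qed.

(** Expand [r_chi], exchange f with its divisor a, write f = ab and sort by the degree of a. *)
Lemma R2_coef_monic (c : {poly F}) N :
  R2_coef charFp chi c g N =
  \sum_(i < N.+1) monic_sum i (fun a =>
    monic_sum (N - i) (fun b => chi a * psi (c * (a * b)))).
Proof.
rewrite /R2_coef fsum_monic -(sum_monic_deg (m := N.+1)) //.
transitivity (\sum_(x : 'rV[F]_N.+1 | (rVpoly x \is monic) && (deg (rVpoly x) == N))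
  \sum_(y : 'rV[F]_N.+1 | (rVpoly y \is monic) && (rVpoly y %| rVpoly x))
    chi (rVpoly y) * psi (c * rVpoly x)).
  apply: eq_bigr => x /andP[xm _].
  by rewrite (r_chiE xm (size_poly _ _)) mulr_suml.
rewrite (exchange_big_dep (fun y => rVpoly y \is monic)) /=; last first.
  by move=> x y _ /andP[].
have sl (y : 'rV[F]_N.+1) : rVpoly y \is monic -> (deg (rVpoly y) <= N)%N.
  move=> ym; have : (size (rVpoly y) <= N.+1)%N by rewrite size_poly.
  by rewrite /deg; have := monic_neq0 ym; rewrite -size_poly_gt0; case: (size _).
transitivity (\sum_(y : 'rV[F]_N.+1 | rVpoly y \is monic)
   monic_sum (N - deg (rVpoly y)) (fun b => chi (rVpoly y) * psi (c * (rVpoly y * b)))).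
  apply: eq_bigr => y ym.
  rewrite -(monic_sum_dvd (fun x => chi (rVpoly y) * psi (c * x))) ?sl //.
  by apply: eq_bigl => x; rewrite ym.
rewrite (partition_big (fun y : 'rV[F]_N.+1 => inord (deg (rVpoly y)) : 'I_N.+1) xpredT) //=.
apply: eq_bigr => i _; rewrite -(sum_monic_deg (m := N.+1)) //.
apply: eq_big => y; last first.
  by move=> /andP[ym /eqP <-]; rewrite inordK // ltnS sl.
by case ym: (_ \is monic) => //=; rewrite -val_eqE /= inordK // ltnS sl.
Qed.

(** The numerator of the rational function [zeta] over 1 - qX. *)
Definition class_poly (a : {poly F}) : {poly C} :=
  (1 - q%:P * 'X) * (if a \is monic then 'X^(deg a) else 0) + 'X^n.

Lemma class_countE (a : 'rV[F]_n) N :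
  class_count C g (rVpoly a) N =
  geo_conv q (fun i => (class_poly (rVpoly a))`_i) N.
Proof.
rewrite geo_conv_telescope /class_count.
have da : rVpoly a \is monic -> (deg (rVpoly a) < n)%N.
  move=> am; have : (size (rVpoly a) <= n)%N by rewrite size_poly.
  by rewrite /deg; have := monic_neq0 am; rewrite -size_poly_gt0; case: (size _).
case: ltnP => nN.
  by rewrite addr0; case: ifP; rewrite ?coef0 // coefXn eq_sym.
by case: ifP => [/da dn|_]; rewrite ?coef0 ?add0r // coefXn gtn_eqF ?add0r // (leq_trans dn).
Qed.

Lemma class_poly_horner (a : 'rV[F]_n) u : q * u != 1 ->
  (class_poly (rVpoly a)).[u] = (1 - q * u) * zeta g u (rVpoly a).
Proof.
move=> qu1; have qu1' : 1 - q * u != 0 by rewrite subr_eq0 eq_sym.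
rewrite /class_poly /zeta mod_rVpoly // mulrDr mulrCA mulfV // mulr1 addrC.
case: (_ \is monic); rewrite !(hornerD, hornerM, hornerN, hornerC, hornerX, hornerXn).
  by rewrite mul1r.
by rewrite mulr0 mul0r mulr0.
Qed.

(** The numerator of [estermann] over (1 - qX)^2. *)
Definition estermann_poly (c : {poly F}) : {poly C} :=
  \sum_(a : 'rV[F]_n) \sum_(b : 'rV[F]_n)
    (chi (rVpoly a) * psi (c * (rVpoly a * rVpoly b)))%:P *
    (class_poly (rVpoly a) * class_poly (rVpoly b)).

(** The summand depends on a and b only modulo g, so both degree sums become residue sums weighted
    by [class_count]; [geo_conv_mul] then multiplies the two generating series. *)
Lemma R2_coefE c N : R2_coef charFp chi c g N =
  geo_conv q (geo_conv q (fun i => (estermann_poly c)`_i)) N.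
Proof.
rewrite R2_coef_monic.
transitivity (\sum_(a : 'rV[F]_n) \sum_(b : 'rV[F]_n)
    (chi (rVpoly a) * psi (c * (rVpoly a * rVpoly b))) *
  \sum_(i < N.+1) class_count C g (rVpoly a) i * class_count C g (rVpoly b) (N - i)).
  under [RHS]eq_bigr => a _ do (under eq_bigr => b _ do rewrite mulr_sumr).
  under [RHS]eq_bigr => a _ do rewrite exchange_big.
  rewrite [RHS]exchange_big; apply: eq_bigr => i _ /=.
  rewrite (monic_sum_class g_monic) /residue_sum; last first.
    move=> x y gxy; apply: eq_bigr => b _.
    rewrite (chi_periodic l_dvd_g chiP gxy) !(mulrC _ (_ + _)) !mulrA.
    by rewrite (psi_periodic R charFp g_monic _ gxy).
  apply: eq_bigr => a _; rewrite (monic_sum_class g_monic) /residue_sum; last first.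
    by move=> x y gxy; rewrite !mulrA (psi_periodic R charFp g_monic _ gxy).
  by rewrite mulr_sumr; apply: eq_bigr => b _; ring.
pose k (ab : 'rV[F]_n * 'rV[F]_n) :=
  chi (rVpoly ab.1) * psi (c * (rVpoly ab.1 * rVpoly ab.2)).
pose P (ab : 'rV[F]_n * 'rV[F]_n) :=
  class_poly (rVpoly ab.1) * class_poly (rVpoly ab.2).
have coefE j : (estermann_poly c)`_j = \sum_ab k ab * (P ab)`_j.
  rewrite /estermann_poly pair_bigA coef_sum; apply: eq_bigr => ab _.
  by rewrite coefCM.
transitivity (geo_conv q (geo_conv q (fun j => \sum_ab k ab * (P ab)`_j)) N); last first.
  by apply: geo_conv_ext => i _; apply: geo_conv_ext => j _; rewrite coefE.
transitivity (geo_conv q (fun i =>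
  \sum_ab k ab * geo_conv q (fun j => (P ab)`_j) i) N); last first.
  by apply: geo_conv_ext => i _; rewrite geo_conv_linear.
rewrite geo_conv_linear pair_bigA; apply: eq_bigr => ab _; congr (_ * _).
rewrite -geo_conv_mul; apply: eq_bigr => i _.
by rewrite !class_countE.
Qed.

Lemma estermann_polyE c u : q * u != 1 ->
  (estermann_poly c).[u] = (1 - q * u) ^+ 2 * estermann charFp g chi c u.
Proof.
move=> qu1; rewrite /estermann_poly horner_sum /estermann /residue_sum mulr_sumr.
apply: eq_bigr => a _; rewrite horner_sum /zetahat /residue_sum !mulr_sumr.
apply: eq_bigr => b _; rewrite !hornerM hornerC !class_poly_horner //.
have -> : rVpoly b * (c * rVpoly a) = c * (rVpoly a * rVpoly b) by ring.
ring.
Qed.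

End Coefficients.

(** * Power series and meromorphic continuation *)

Import ComplexField.Normc.

(** * Limits and neighbourhoods through the real-valued modulus *)

Section ComplexTopology.
Variable R : realType.
Local Notation C := R[i].
Local Notation normc := (@normc R).

Lemma normr_normc (z : C) : `|z| = (normc z)%:C%C.
Proof. by []. Qed.

Lemma normc_ge0 (z : C) : 0 <= normc z.
Proof. by case: z => a b; exact: sqrtr_ge0. Qed.

Lemma normc_eq0 (z : C) : (normc z == 0) = (z == 0).
Proof.
apply/eqP/eqP => [|->]; [exact: eq0_normc | exact: normc0].
Qed.

Lemma normcX (z : C) k : normc (z ^+ k) = normc z ^+ k.
Proof.
by elim: k => [|k IH]; rewrite ?normc1 // !exprS normcM IH.
Qed.

Lemma posC_real (e : C) : 0 < e -> exists2 d : R, 0 < d & e = d%:C%C.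
Proof.
case: e => a b; rewrite ltcE /= => /andP[/eqP -> a0]; exists a => //.
Qed.

(** The norm of [R[i]] is itself complex-valued; passing to [normc] opens estimates to real
    arithmetic. *)
Lemma cvg_normcP (u : nat -> C) (s : C) :
  ((u : nat -> C^o) @ \oo --> (s : C^o)) <->
  (forall e : R, 0 < e -> exists N, forall n, (N <= n)%N -> normc (u n - s) < e).
Proof.
split=> [/cvgrPdistC_lt h e e0|h].
  have /h [N _ hN] : (0 : C) < e%:C%C by rewrite ltcR.
  by exists N => n Nn; have := hN n Nn; rewrite /= normr_normc ltcR.
apply/cvgrPdistC_lt => e /posC_real [d d0 ->].
have [N hN] := h d d0; exists N => // n Nn.
by rewrite /= normr_normc ltcR hN.
Qed.

Lemma nearCP (z0 : C) (P : C -> Prop) :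
  (\forall z \near (z0 : C^o), P z) <->
  exists2 e : R, 0 < e & forall z, normc (z - z0) < e -> P z.
Proof.
split=> [/nbhs_normP[e /= /posC_real [d d0 ->] h]|[e e0 h]].
  by exists d => // z zd; apply: h; rewrite /= distrC normr_normc ltcR.
apply/nbhs_normP; exists e%:C%C; rewrite /= ?ltcR // => z /=.
by rewrite distrC normr_normc ltcR; exact: h.
Qed.

Lemma dnearCP (z0 : C) (P : C -> Prop) :
  (\forall z \near (z0 : C^o)^', P z) <->
  exists2 e : R, 0 < e & forall z, z != z0 -> normc (z - z0) < e -> P z.
Proof.
split=> [/nearCP [e e0 h]|[e e0 h]].
  by exists e => // z zz0 ze; exact: h.
by apply/nearCP; exists e => // z ze zz0; exact: h.
Qed.

Lemma contraction_cvg0 (y e : nat -> R) (r : R) : 0 <= r < 1 ->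
  (forall n, 0 <= y n) -> (forall n, y n.+1 <= e n + r * y n) ->
  (forall d, 0 < d -> exists N, forall n, (N <= n)%N -> e n < d) ->
  forall d, 0 < d -> exists N, forall n, (N <= n)%N -> y n < d.
Proof.
move=> /andP[r0 r1] y0 rec ecv d d0.
(* With this bound on the perturbation, d/2 is the fixed point of y -> e + r y. *)
have e0 : 0 < d * (1 - r) / 2 by rewrite divr_gt0 // mulr_gt0 // subr_gt0.
have [N hN] := ecv _ e0.
have b k : y (N + k)%N <= d / 2 + r ^+ k * y N.
  elim: k => [|k IH]; first by rewrite addn0 expr0 mul1r lerDr; lra.
  rewrite addnS (le_trans (rec _)) //.
  have := hN (N + k)%N (leq_addr _ _); have := ler_wpM2l r0 IH.
  rewrite exprS; lra.
have y1 : 0 < y N + 1 by have := y0 N; lra.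
have d1 : 0 < d / 2 / (y N + 1) by rewrite !divr_gt0.
have /cvgrPdistC_lt /(_ _ d1) [M _ hM] : (GRing.exp r : R ^nat) @ \oo --> 0.
  by apply: cvg_expr; rewrite ger0_norm.
exists (N + M)%N => n nNM.
have -> : n = (N + (n - N))%N by rewrite subnKC // (leq_trans _ nNM) // leq_addr.
apply: le_lt_trans (b _) _.
have Mn : (M <= n - N)%N by rewrite leq_subRL // (leq_trans _ nNM) // leq_addr.
have := hM _ Mn; rewrite /= subr0 ger0_norm ?exprn_ge0 // ltr_pdivlMr // => h.
have := y0 N; have := exprn_ge0 (n - N)%N r0; lra.
Qed.

End ComplexTopology.

(** * Sums of power series and division by a linear factor *)

Section PowerSeries.
Variable R : realType.
Local Notation C := R[i].
Local Notation normc := (@normc R).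

Definition psum (a : nat -> C) (z : C) (N : nat) : C := \sum_(k < N) a k * z ^+ k.

Lemma psum_toP (a : nat -> C) (z s : C) : psum_to a z s <->
  (forall e : R, 0 < e -> exists N, forall n, (N <= n)%N -> normc (psum a z n - s) < e).
Proof.
rewrite /psum_to -cvg_normcP.
have -> // : series (fun n => a n * z ^+ n) = psum a z :> (nat -> C^o).
by apply/funext => n; rewrite /series /= /psum big_mkord.
Qed.

Lemma psum_to_ext a b (z s : C) : a =1 b -> psum_to a z s -> psum_to b z s.
Proof. by move=> /funext ->. Qed.

Lemma psum_to_poly (P : {poly C}) (z : C) : psum_to (fun i => P`_i) z P.[z].
Proof.
apply/psum_toP => e e0; exists (size P) => n Pn.
by rewrite /psum (horner_coef_wide z Pn) subrr normc0.
Qed.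

Lemma psum_to_sub a b (z s t : C) : psum_to a z s -> psum_to b z t ->
  psum_to (fun n => a n - b n) z (s - t).
Proof.
move=> /psum_toP sa /psum_toP tb; apply/psum_toP => e e0.
have e2 : 0 < e / 2 by rewrite divr_gt0.
have [N hN] := sa _ e2; have [M hM] := tb _ e2.
exists (maxn N M) => k; rewrite geq_max => /andP[Nk Mk].
have -> : psum (fun n => a n - b n) z k - (s - t) =
    (psum a z k - s) + - (psum b z k - t).
  rewrite /psum; under eq_bigr do rewrite mulrBl.
  by rewrite sumrB; ring.
have := le_normcD (psum a z k - s) (- (psum b z k - t)); rewrite normcN.
have := hN k Nk; have := hM k Mk; lra.
Qed.

Lemma geo_convS (theta : C) s k :
  geo_conv theta s k.+1 = s k.+1 + theta * geo_conv theta s k.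
Proof.
rewrite /geo_conv big_ord_recr /= subnn expr0 mul1r addrC; congr (_ + _).
rewrite mulr_sumr; apply: eq_bigr => i _.
by rewrite subSn ?exprS ?mulrA // -ltnS.
Qed.

Lemma psum_geo_conv theta s z N :
  psum (geo_conv theta s) z N.+1 = psum s z N.+1 + theta * z * psum (geo_conv theta s) z N.
Proof.
elim: N => [|N IH].
  by rewrite /psum !big_ord_recl !big_ord0 /geo_conv big_ord_recl big_ord0 /=;
    rewrite mulr0 !expr0 !mul1r !addr0.
have psumS a M : psum a z M.+1 = psum a z M + a M * z ^+ M.
  by rewrite /psum big_ord_recr.
rewrite psumS [in LHS]IH [psum s z N.+2]psumS geo_convS.
rewrite [psum (geo_conv theta s) z N.+1 in RHS]psumS exprS.
ring.
Qed.

(** By [psum_geo_conv] the error of each partial sum is at most the error for s plus |theta z| times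
    the preceding error, a contraction. *)
Lemma psum_to_geo (theta : C) s z S0 : normc (theta * z) < 1 -> psum_to s z S0 ->
  psum_to (geo_conv theta s) z (S0 / (1 - theta * z)).
Proof.
move=> tz /psum_toP sS; apply/psum_toP; set L := S0 / _.
have tz1 : 1 - theta * z != 0.
  by apply: contraTneq tz => /subr0_eq <-; rewrite normc1 ltxx.
have SL : S0 = L - theta * z * L by rewrite /L; field.
apply: (contraction_cvg0 (e := fun n => normc (psum s z n.+1 - S0)) (r := normc (theta * z))).
- by rewrite normc_ge0.
- by move=> n; exact: normc_ge0.
- move=> n; rewrite psum_geo_conv SL -normcM.
  have -> : psum s z n.+1 + theta * z * psum (geo_conv theta s) z n - L =
    (psum s z n.+1 - (L - theta * z * L)) + theta * z * (psum (geo_conv theta s) z n - L) by ring.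
  exact: le_normcD.
- by move=> d /sS [N hN]; exists N => n Nn; apply: hN; rewrite (leq_trans Nn).
Qed.

End PowerSeries.

(** * Rational functions with denominator a power of 1 - qz *)

Section RationalFunctions.
Variable R : realType.
Local Notation C := R[i].
Local Notation normc := (@normc R).

(* Coefficients of (\sum_i s_i X^i) / (1 - theta X)^k. *)
Fixpoint geo_iter (theta : C) k (s : nat -> C) : nat -> C :=
  if k is k'.+1 then geo_conv theta (geo_iter theta k' s) else s.

Lemma psum_to_geo_iter theta k s (z S0 : C) :
  normc (theta * z) < 1 -> psum_to s z S0 ->
  psum_to (geo_iter theta k s) z (S0 / (1 - theta * z) ^+ k).
Proof.
move=> tz sS; elim: k => [|k IH] /=; first by rewrite expr0 divr1.
by rewrite exprSr invfM mulrA; apply: psum_to_geo.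
Qed.

(** Recentring gives 1 - qz = (1 - q z0)(1 - theta (z - z0)), so the expansion at z0 is an iterated
    geometric convolution of the recentred numerator. *)
Lemma analytic_ratio (P : {poly C}) (q : C) k (z0 : C) (f : C -> C) :
  q * z0 != 1 -> (forall z, q * z != 1 -> f z = P.[z] / (1 - q * z) ^+ k) ->
  analytic_at f z0.
Proof.
move=> qz0 fE; have w0 : 1 - q * z0 != 0 by rewrite subr_eq0 eq_sym.
pose theta := q / (1 - q * z0).
pose A := ((1 - q * z0) ^- k)%:P * (P \Po ('X + z0%:P)).
exists (geo_iter theta k (fun i => A`_i)).
have N1 : 0 < normc theta + 1 by have := normc_ge0 theta; lra.
(* This radius forces |theta (z - z0)| < 1, and the added 1 covers theta = 0. *)
apply/nearCP; exists (normc theta + 1)^-1; rewrite ?invr_gt0 // => z.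
rewrite -div1r ltr_pdivlMr // => zz.
have tz : normc (theta * (z - z0)) < 1.
  have := normc_ge0 (z - z0); rewrite normcM; lra.
have wE : 1 - q * z = (1 - q * z0) * (1 - theta * (z - z0)).
  by rewrite /theta; field.
have tz1 : 1 - theta * (z - z0) != 0.
  by apply: contraTneq tz => /subr0_eq <-; rewrite normc1 ltxx.
have wz : q * z != 1 by rewrite eq_sym -subr_eq0 wE mulf_neq0.
have -> : f z = A.[z - z0] / (1 - theta * (z - z0)) ^+ k.
  rewrite (fE _ wz) wE hornerM hornerC horner_comp hornerD hornerX hornerC subrK.
  set X := 1 - q * z0; set Y := 1 - theta * (z - z0).
  by rewrite [(X * Y) ^+ k]exprMn [(_ * _)^-1]invfM mulrA [P.[z] * _]mulrC.
exact: (psum_to_geo_iter tz (@psum_to_poly _ A (z - z0))).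
Qed.

Lemma pole_ratio (P : {poly C}) (q : C) k (f : C -> C) : q != 0 ->
  P.[q^-1] != 0 -> (forall z, q * z != 1 -> f z = P.[z] / (1 - q * z) ^+ k.+1) ->
  pole_at f q^-1.
Proof.
move=> q0 P0 fE; pose A := ((- q) ^- k.+1)%:P * (P \Po ('X + (q^-1)%:P)).
have nq0 : - q != 0 by rewrite oppr_eq0.
have AE h : A.[h] = (- q) ^- k.+1 * P.[h + q^-1].
  by rewrite hornerM hornerC horner_comp hornerD hornerX hornerC.
exists k, (fun i => A`_i); split.
  by rewrite -horner_coef0 AE add0r mulf_neq0 ?invr_eq0 ?expf_neq0.
apply/dnearCP; exists 1 => // z zq _.
have zq0 : z - q^-1 != 0 by rewrite subr_eq0.
have wE : 1 - q * z = - q * (z - q^-1) by field.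
have -> : (z - q^-1) ^+ k.+1 * f z = A.[z - q^-1].
  rewrite fE ?wE; last by rewrite eq_sym -subr_eq0 wE mulf_neq0.
  rewrite AE subrK exprMn; set X := (z - q^-1) ^+ k.+1; set Y := (- q) ^+ k.+1.
  by field; rewrite /X /Y !expf_neq0.
exact: psum_to_poly.
Qed.

(** Cancels common factors, so that any remaining denominator yields a genuine pole and a removable
    singularity at 1/q gets its true value. *)
Lemma ratio_reduce (P : {poly C}) (q : C) k : q != 0 ->
  exists j Q, (j = 0%N \/ Q.[q^-1] != 0) /\
    forall z, q * z != 1 -> P.[z] / (1 - q * z) ^+ k = Q.[z] / (1 - q * z) ^+ j.
Proof.
move=> q0; elim: k P => [|k IH] P; first by exists 0%N, P; split; [left|].
have [P0|P0] := eqVneq P.[q^-1] 0; last first.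
  by exists k.+1, P; split; [right|].
have /factor_theorem [Q PQ] : root P q^-1 by apply/eqP.
have [j [Q' [jQ e]]] := IH (- (q^-1)%:P * Q).
exists j, Q'; split=> // z qz; rewrite -e // PQ !hornerE exprS.
have w0 : 1 - q * z != 0 by rewrite subr_eq0 eq_sym.
have -> : z - q^-1 = - q^-1 * (1 - q * z) by field.
have W0 : (1 - q * z) ^+ k != 0 by rewrite expf_neq0.
move: W0; set W := _ ^+ k => W0.
by field; rewrite W0 q0.
Qed.

Lemma meromorphic_ratio (P : {poly C}) (q : C) k : q != 0 ->
  exists G, meromorphic G /\ forall z, q * z != 1 -> G z = P.[z] / (1 - q * z) ^+ k.
Proof.
move=> q0; have [j [Q [jQ e]]] := ratio_reduce P k q0.
case: j jQ e => [|j] jQ e.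
  exists (fun z => Q.[z]); split=> [z0|z qz]; last by rewrite e // expr0 divr1.
  left; apply: (analytic_ratio (P := Q) (q := 0) (k := 0)).
    by rewrite mul0r eq_sym oner_eq0.
  by move=> z _; rewrite expr0 divr1.
exists (fun z => Q.[z] / (1 - q * z) ^+ j.+1); split=> [z0|z qz]; last by rewrite e.
have [qz|qz] := eqVneq (q * z0) 1; last first.
  by left; apply: (analytic_ratio (P := Q) (k := j.+1) qz).
right; have -> : z0 = q^-1 by apply: (mulfI q0); rewrite qz mulfV.
by apply: (pole_ratio (P := Q) (k := j)) => //; case: jQ.
Qed.

End RationalFunctions.

(** * Isolated zeros of power series *)

Section Identity.
Variable R : realType.
Local Notation C := R[i].
Local Notation normc := (@normc R).

(** A late term is the difference of two partial sums within 1 of the limit; the early ones are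
    bounded by their sum. *)
Lemma psum_to_terms_bounded (a : nat -> C) (z s : C) : psum_to a z s ->
  exists2 B : R, 0 <= B & forall k, normc (a k) * normc z ^+ k <= B.
Proof.
move=> /psum_toP /(_ 1 ltr01) [N hN].
have sum_ge0 : 0 <= \sum_(k < N) normc (a k) * normc z ^+ k.
  by apply: sumr_ge0 => k _; rewrite mulr_ge0 ?exprn_ge0 ?normc_ge0.
exists (\sum_(k < N) normc (a k) * normc z ^+ k + 2) => [|k]; first by lra.
have [kN|Nk] := ltnP k N.
  rewrite (bigD1 (Ordinal kN)) //=.
  have : 0 <= \sum_(i < N | i != Ordinal kN) normc (a i) * normc z ^+ i.
    by apply: sumr_ge0 => i _; rewrite mulr_ge0 ?exprn_ge0 ?normc_ge0.
  lra.
rewrite -normcX -normcM.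
have -> : a k * z ^+ k = (psum a z k.+1 - s) + - (psum a z k - s).
  by rewrite /psum big_ord_recr /=; ring.
have := le_normcD (psum a z k.+1 - s) (- (psum a z k - s)); rewrite normcN.
have := hN k Nk; have := hN k.+1 (leqW Nk); lra.
Qed.

Lemma psum_bound (b : nat -> C) (z : C) (r B : R) N :
  (forall k, normc (b k) * r ^+ k <= B) -> normc z <= r / 2 ->
  normc (psum b z N) <= 2 * B.
Proof.
move=> hB zr; have z0 := normc_ge0 z.
have B0 : 0 <= B by apply: le_trans (hB 0%N); rewrite mulr_ge0 ?normc_ge0.
(* The k-th term is at most B/2^k; the exact geometric sum makes the induction close. *)
suff : normc (psum b z N) <= 2 * B * (1 - 2^-1 ^+ N).
  have : 0 <= (2^-1 : R) ^+ N by rewrite exprn_ge0.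
  by have := mulr_ge0 B0; nra.
elim: N => [|N IH]; first by rewrite /psum big_ord0 normc0 expr0 subrr mulr0.
rewrite /psum big_ord_recr /= -/(psum b z N).
apply: le_trans (le_normcD _ _) _.
have t : normc (b N * z ^+ N) <= B * 2^-1 ^+ N.
  rewrite normcM normcX.
  have : normc z ^+ N <= (r * 2^-1) ^+ N.
    by apply: lerXn2r; rewrite ?nnegrE //; lra.
  rewrite exprMn => /(ler_wpM2l (normc_ge0 (b N))) /le_trans; apply.
  by rewrite mulrA ler_wpM2r // exprn_ge0.
rewrite exprS; lra.
Qed.

Lemma psum_shift (a : nat -> C) (z : C) N :
  psum a z N.+1 = a 0%N + z * psum (fun k => a k.+1) z N.
Proof.
rewrite /psum big_ord_recl expr0 mulr1; congr (_ + _).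
rewrite mulr_sumr; apply: eq_bigr => k _ /=.
by rewrite /bump /= add1n exprS mulrCA.
Qed.

Lemma psum_to_linear_bound (a : nat -> C) (z1 s1 : C) : z1 != 0 ->
  psum_to a z1 s1 -> exists2 M : R, 0 <= M &
    forall z s, normc z <= normc z1 / 2 -> psum_to a z s ->
      normc (s - a 0%N) <= M * normc z.
Proof.
move=> z10 /psum_to_terms_bounded [B B0 hB].
have r0 : 0 < normc z1 by rewrite lt0r normc_eq0 z10 normc_ge0.
(* After a factor z is taken out, the shifted coefficients satisfy the term bound at z1 with B/|z1|
   in place of B. *)
exists (2 * (B / normc z1)); first by rewrite mulr_ge0 // divr_ge0 // ltW.
move=> z s zr /psum_toP sz; apply/ler_addgt0Pr => e e0.
have [N hN] := sz e e0; have := hN N.+1 (leqnSn _); rewrite psum_shift.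
set w := z * psum _ _ _ => he.
have -> : s - a 0%N = - (a 0%N + w - s) + w by ring.
apply: le_trans (le_normcD _ _) _; rewrite normcN.
have : normc w <= 2 * (B / normc z1) * normc z.
  rewrite /w normcM mulrC ler_wpM2r ?normc_ge0 //.
  apply: (psum_bound (r := normc z1)) => // k.
  rewrite ler_pdivlMr //; have := hB k.+1; by rewrite exprSr mulrA.
lra.
Qed.

Lemma psum_to_shift (a : nat -> C) (z s : C) : z != 0 -> psum_to a z s ->
  psum_to (fun k => a k.+1) z ((s - a 0%N) / z).
Proof.
move=> z0 /psum_toP sz; apply/psum_toP => e e0.
have r0 : 0 < normc z by rewrite lt0r normc_eq0 z0 normc_ge0.
have [N hN] := sz (e * normc z) (mulr_gt0 e0 r0).
exists N => n Nn; have := hN n.+1 (leqW Nn); rewrite psum_shift.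
have -> : a 0%N + z * psum (fun k => a k.+1) z n - s =
  (psum (fun k => a k.+1) z n - (s - a 0%N) / z) * z by field.
by rewrite normcM ltr_pM2r.
Qed.

Lemma psum_to0 (a : nat -> C) (s : C) : psum_to a 0 s -> s = a 0%N.
Proof.
move=> /psum_toP h; apply/eqP; rewrite -subr_eq0 -normc_eq0 eq_le normc_ge0 andbT.
apply/ler_addgt0Pr => e e0; have [N hN] := h e e0.
have := hN N.+1 (leqnSn _); rewrite psum_shift mul0r addr0 -normcN opprB add0r.
exact: ltW.
Qed.

(** At a zero z near 0 the linear bound reads |a_0| <= M |z|, and such z are arbitrarily small. *)
Lemma psum_to_zeros0 (a : nat -> C) (r : R) : 0 < r ->
  (forall z, z != 0 -> normc z < r -> exists s, psum_to a z s) ->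
  (forall e : R, 0 < e -> exists z, [/\ z != 0, normc z < e & psum_to a z 0]) ->
  a 0%N = 0.
Proof.
move=> r0 conv zeros; have [z1 [z10 z1r _]] := zeros r r0.
have [s1 sz1] := conv z1 z10 z1r.
have [M M0 hM] := psum_to_linear_bound z10 sz1.
have r1 : 0 < normc z1 by rewrite lt0r normc_eq0 z10 normc_ge0.
apply/eqP; rewrite -normc_eq0 eq_le normc_ge0 andbT.
apply/ler_addgt0Pr => e e0; rewrite add0r.
pose d := Num.min (normc z1 / 2) (e / (M + 1)).
have d0 : 0 < d by rewrite lt_min !divr_gt0 //; lra.
have [z [z0 zd sz]] := zeros d d0.
move: zd; rewrite lt_min => /andP[zd1 zd2].
have := hM z 0 (ltW zd1) sz; rewrite sub0r normcN => /le_trans; apply.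
have M1 : 0 < M + 1 by lra.
move: zd2; rewrite ltr_pdivlMr // => zd2; have := normc_ge0 z; nra.
Qed.

(** Once a_0 = 0, dividing by z keeps the nonzero zeros and shifts the coefficients. *)
Lemma psum_to_zeros (a : nat -> C) (r : R) : 0 < r ->
  (forall z, z != 0 -> normc z < r -> exists s, psum_to a z s) ->
  (forall e : R, 0 < e -> exists z, [/\ z != 0, normc z < e & psum_to a z 0]) ->
  forall n, a n = 0.
Proof.
move=> r0 conv zeros n; elim: n a conv zeros => [|n IH] a conv zeros.
  exact: psum_to_zeros0 conv zeros.
have a0 := psum_to_zeros0 r0 conv zeros.
apply: (IH (fun k => a k.+1)) => [z z0 zr|e e0].
  have [s sz] := conv z z0 zr.
  by exists ((s - a 0%N) / z); exact: psum_to_shift.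
have [z [z0 ze sz]] := zeros e e0; exists z; split=> //.
by have := psum_to_shift z0 sz; rewrite a0 subrr mul0r.
Qed.

Lemma psum_to_uniq (a : nat -> C) (z s t : C) :
  psum_to a z s -> psum_to a z t -> s = t.
Proof.
move=> /psum_toP sa /psum_toP ta; apply/eqP; rewrite -subr_eq0 -normc_eq0.
rewrite eq_le normc_ge0 andbT; apply/ler_addgt0Pr => e e0; rewrite add0r.
have e2 : 0 < e / 2 by rewrite divr_gt0.
have [N hN] := sa _ e2; have [M hM] := ta _ e2.
have -> : s - t = (psum a z (N + M) - t) + - (psum a z (N + M) - s) by ring.
apply: le_trans (le_normcD _ _) _; rewrite normcN.
have := hN (N + M)%N (leq_addr _ _); have := hM (N + M)%N (leq_addl _ _); lra.
Qed.

(** Punctured neighbourhoods are used because a function carries no information at its poles. *)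
Definition locally_series (h : C -> C) (z0 : C) :=
  exists a : nat -> C, \forall z \near (z0 : C^o)^', psum_to a (z - z0) (h z).

(** Either the zeros keep away from z0, or they accumulate there and all coefficients vanish. *)
Lemma isolated_zeros (h : C -> C) (z0 : C) : locally_series h z0 ->
  (\forall z \near (z0 : C^o)^', h z = 0) \/
  (\forall z \near (z0 : C^o)^', h z != 0).
Proof.
move=> [a /dnearCP [r r0 ha]].
have [[e e0 he]|no] := pselect (exists2 e : R, 0 < e &
    forall z, z != z0 -> normc (z - z0) < e -> h z != 0).
  by right; apply/dnearCP; exists e.
left; have a0 : forall n, a n = 0.
  apply: (psum_to_zeros r0) => [z zn0 zr|e e0].
    exists (h (z + z0)); rewrite -{1}[z](addrK z0); apply: ha.
      by rewrite -subr_eq0 addrK.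
    by rewrite addrK.
  apply: contrapT => hno; apply: no; exists (Num.min e r); first by rewrite lt_min e0.
  move=> z zz0; rewrite lt_min => /andP[ze zr]; apply/negP => /eqP hz.
  apply: hno; exists (z - z0); split=> //; first by rewrite subr_eq0.
  by rewrite -hz; exact: ha.
apply/dnearCP; exists r => // z zz0 zr.
have := ha z zz0 zr; have -> : a = (fun i => (0 : {poly C})`_i).
  by apply/funext => n; rewrite a0 coef0.
by move=> hz; rewrite (psum_to_uniq hz (@psum_to_poly _ 0 _)) horner0.
Qed.

Lemma psum_to_linear_mul (alpha beta : C) (a : nat -> C) : exists b : nat -> C,
  forall z s, psum_to a z s -> psum_to b z ((alpha + beta * z) * s).
Proof.
pose a' n := if n is k.+1 then a k else 0.
exists (fun n => alpha * a n + beta * a' n) => z s /psum_toP sa.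
have psE n : psum (fun n => alpha * a n + beta * a' n) z n.+1 - (alpha + beta * z) * s =
    alpha * (psum a z n.+1 - s) + beta * z * (psum a z n - s).
  have -> : psum (fun n => alpha * a n + beta * a' n) z n.+1 =
      alpha * psum a z n.+1 + beta * psum a' z n.+1.
    rewrite /psum !mulr_sumr -big_split; apply: eq_bigr => k _ /=; ring.
  rewrite (psum_shift a') add0r; ring.
apply/psum_toP => e e0.
pose K := normc alpha + normc (beta * z) + 1.
have K0 : 0 < K by have := normc_ge0 alpha; have := normc_ge0 (beta * z); rewrite /K; lra.
have [N hN] := sa (e / K) (divr_gt0 e0 K0).
exists N.+1 => -[|n] // Nn; rewrite psE.
apply: le_lt_trans (le_normcD _ _) _; rewrite !(normcM _ (psum _ _ _ - _)).
have := hN n Nn; have := hN n.+1 (leqW Nn); rewrite !ltr_pdivlMr // => h1 h2.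
have := normc_ge0 alpha; have := normc_ge0 (beta * z).
have := normc_ge0 (psum a z n - s); have := normc_ge0 (psum a z n.+1 - s).
set A := normc _ in h1 *; set B := normc _ in h2 *; set X := normc _; set Y := normc _.
move=> A0 B0 X0 Y0.
have K1 : K = Y + X + 1 by [].
have : (Y * A + X * B) * K < e * K by rewrite K1 in h1 h2 *; nra.
by rewrite ltr_pM2r.
Qed.

Lemma locally_series_linear_mul (alpha beta z0 : C) h : locally_series h z0 ->
  locally_series (fun z => (alpha + beta * z) * h z) z0.
Proof.
move=> [a ha]; have [b hb] := psum_to_linear_mul (alpha + beta * z0) beta a.
exists b; apply: filterS ha => z /hb.
by have -> : alpha + beta * z0 + beta * (z - z0) = alpha + beta * z by ring.
Qed.

Lemma locally_series_sub z0 h1 h2 : locally_series h1 z0 -> locally_series h2 z0 ->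
  locally_series (fun z => h1 z - h2 z) z0.
Proof.
move=> [a ha] [b hb]; exists (fun n => a n - b n).
apply: filterS2 ha hb => z; exact: psum_to_sub.
Qed.

Lemma locally_series_poly z0 (P : {poly C}) : locally_series (fun z => P.[z]) z0.
Proof.
exists (fun i => (P \Po ('X + z0%:P))`_i); apply/dnearCP; exists 1 => // z _ _.
have -> : P.[z] = (P \Po ('X + z0%:P)).[z - z0].
  by rewrite horner_comp hornerD hornerX hornerC subrK.
exact: psum_to_poly.
Qed.

End Identity.

(** * The identity theorem on the complex plane *)

Section Continuation.
Variable R : realType.
Local Notation C := R[i].
Local Notation normc := (@normc R).

Lemma locally_series_pow_mul (alpha beta z0 : C) h k : locally_series h z0 ->
  locally_series (fun z => (alpha + beta * z) ^+ k * h z) z0.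
Proof.
move=> hs; elim: k => [|k IH].
  by have -> : (fun z => (alpha + beta * z) ^+ 0 * h z) = h
    by apply/funext => z; rewrite expr0 mul1r.
have -> : (fun z => (alpha + beta * z) ^+ k.+1 * h z) =
    (fun z => (alpha + beta * z) * ((alpha + beta * z) ^+ k * h z)).
  by apply/funext => z; rewrite exprS mulrA.
exact: locally_series_linear_mul.
Qed.

Lemma meromorphic_locally_series (f : C -> C) (z0 : C) : meromorphic f ->
  exists m, locally_series (fun z => (z - z0) ^+ m * f z) z0.
Proof.
move=> /(_ z0) [[a ha]|[N [a [_ ha]]]]; last by exists N.+1, a.
exists 0%N, a; have [e e0 he] := iffLR (nearCP _ _) ha.
by apply/dnearCP; exists e => // z _ ze; rewrite expr0 mul1r; exact: he.
Qed.

Lemma dnear_open (Q : C -> Prop) (z0 : C) : (\forall z \near (z0 : C^o)^', Q z) ->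
  exists2 e : R, 0 < e & forall z1, normc (z1 - z0) < e ->
    \forall z \near (z1 : C^o)^', Q z.
Proof.
move=> /dnearCP [e e0 he]; exists (e / 2); first by rewrite divr_gt0.
move=> z1 z1e; have [->|z10] := eqVneq z1 z0; first by apply/dnearCP; exists e.
have d0 : 0 < normc (z1 - z0) by rewrite lt0r normc_ge0 normc_eq0 subr_eq0 z10.
(* The second bound keeps z away from z0, the first keeps it in the disc of radius e. *)
apply/dnearCP; exists (Num.min (e / 2) (normc (z1 - z0))).
  by rewrite lt_min divr_gt0.
move=> z _; rewrite lt_min => /andP[zd1 zd2]; apply: he.
  by apply: contraTneq zd2 => ->; rewrite -normcN opprB ltxx.
have -> : z - z0 = (z - z1) + (z1 - z0) by ring.
apply: le_lt_trans (le_normcD _ _) _; lra.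
Qed.

(** Restrict to the real line t -> tw through 0 and w: the parameters of local vanishing and of
    local nonvanishing form complementary open sets, and the real line is connected. *)
Lemma zero_propagates (D : C -> C) :
  (forall z0 : C, (\forall z \near (z0 : C^o)^', D z = 0) \/
                  (\forall z \near (z0 : C^o)^', D z != 0)) ->
  (\forall z \near (0 : C^o)^', D z = 0) ->
  forall z0 : C, \forall z \near (z0 : C^o)^', D z = 0.
Proof.
move=> dich D0 w.
pose line (t : R) : C := t%:C%C * w.
have line_open (Q : C -> Prop) :
    open [set t : R | \forall z \near (line t : C^o)^', Q z].
  rewrite openE => t /= /dnear_open [e e0 he].
  have w1 : 0 < normc w + 1 by have := normc_ge0 w; lra.
  apply/nbhs_ballP; exists (e / (normc w + 1)); first by rewrite /= divr_gt0.
  move=> t' /=; rewrite /ball /= ltr_pdivlMr // => tt'; apply: he.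
  have -> : line t' - line t = (t' - t)%:C%C * w by rewrite /line rmorphB; ring.
  rewrite normcM; have -> : normc (t' - t)%:C%C = `|t - t'|.
    by rewrite /= expr0n /= addr0 sqrtr_sqr distrC.
  have := normc_ge0 w; have := normr_ge0 (t - t'); nra.
pose B := [set t : R | \forall z \near (line t : C^o)^', D z = 0].
pose B' := [set t : R | \forall z \near (line t : C^o)^', D z != 0].
have BB' : B = ~` B'.
  apply/seteqP; split=> [t /dnearCP [e e0 he] /dnearCP [d d0 hd]|t nB']; last first.
    have [h|h] := dich (line t); first exact h.
    exact (False_ind _ (nB' h)).
  (* The point at distance m lies in both punctured discs, where D would be zero and nonzero at
     once. *)
  pose m := Num.min e d / 2; have m0 : 0 < m by rewrite divr_gt0 // lt_min e0.
  have mz : (m%:C)%C != 0 :> C by rewrite -normc_eq0 /= expr0n /= addr0 sqrtr_sqr normr_eq0 gt_eqF.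
  have mn : normc (line t + m%:C%C - line t) = m.
    by rewrite addrC addKr /= expr0n /= addr0 sqrtr_sqr gtr0_norm.
  have ml : line t + m%:C%C != line t by rewrite -subr_eq0 addrC addKr.
  have mm : m < Num.min e d by rewrite /m ltr_pdivrMr // ltr_pMr ?ltr1n // lt_min e0.
  move: mm; rewrite lt_min -mn => /andP[me md].
  by have := hd _ ml md; rewrite (he _ ml me) eqxx.
have cT : connected [set: R] by apply/connected_intervalP.
have : B = setT.
  apply: cT.
  - by exists 0; rewrite /B /line /= mul0r.
  - by exists B; rewrite ?setTI //; exact: line_open.
  - exists B; last by rewrite setTI.
    rewrite BB'; apply: open_closedC; exact: line_open.
move=> /seteqP [_ /(_ 1 I)]; by rewrite /B /line /= mul1r.
Qed.

(** A power of z - w clears the possible pole of f at w without changing the zeros of the difference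
    off w, so isolation of zeros applies at every w. *)
Lemma meromorphic_ratio_unique (f : C -> C) (P : {poly C}) (q : C) k :
  meromorphic f ->
  (\forall z \near (0 : C^o)^', (1 - q * z) ^+ k * f z = P.[z]) ->
  forall z0 : C, \forall z \near (z0 : C^o)^', (1 - q * z) ^+ k * f z = P.[z].
Proof.
move=> fmer f0 z0; pose D z := (1 - q * z) ^+ k * f z - P.[z].
suff : \forall z \near (z0 : C^o)^', D z = 0.
  by apply: filterS => z /eqP; rewrite subr_eq0 => /eqP.
apply: zero_propagates; last by apply: filterS f0 => z e; rewrite /D e subrr.
move=> w; have [m hm] := meromorphic_locally_series w fmer.
have /isolated_zeros : locally_series (fun z => (1 + - q * z) ^+ k * ((z - w) ^+ m * f z)
     - (- w + 1 * z) ^+ m * P.[z]) w.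
  apply: locally_series_sub; first exact: locally_series_pow_mul.
  exact/locally_series_pow_mul/locally_series_poly.
have DE z : (1 + - q * z) ^+ k * ((z - w) ^+ m * f z) - (- w + 1 * z) ^+ m * P.[z] =
    (z - w) ^+ m * D z.
  by rewrite mul1r [- w + z]addrC /D mulNr; ring.
case=> /dnearCP [e e0 he]; [left|right]; apply/dnearCP; exists e => // z zw ze;
  have := he z zw ze; rewrite DE.
  move=> /eqP; rewrite mulf_eq0 expf_eq0 subr_eq0 (negPf zw) andbF /=.
  by move/eqP.
by apply: contra => /eqP ->; rewrite mulr0.
Qed.

Lemma analytic_cvg (f : C -> C) (z0 : C) : analytic_at f z0 ->
  (f : C^o -> C^o) z @[z --> (z0 : C^o)^'] --> (f z0 : C^o).
Proof.
move=> [a /nearCP [r r0 ha]].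
have f0 : f z0 = a 0%N.
  have := ha z0; rewrite subrr normc0 => /(_ r0); exact: psum_to0.
pose z1 : C := (r / 2)%:C%C.
have nz1 : normc z1 = r / 2 by rewrite /= expr0n /= addr0 sqrtr_sqr gtr0_norm // divr_gt0.
have z10 : z1 != 0 by rewrite -normc_eq0 nz1 gt_eqF // divr_gt0.
have s1 : psum_to a z1 (f (z0 + z1)).
  have := ha (z0 + z1); rewrite [z0 + z1]addrC addrK nz1; apply; lra.
have [M M0 hM] := psum_to_linear_bound z10 s1.
apply/cvgrPdistC_lt => e /posC_real [d d0 ->].
have M1 : 0 < M + 1 by lra.
apply/dnearCP; exists (Num.min (r / 4) (d / (M + 1))).
  by rewrite lt_min !divr_gt0.
move=> z _; rewrite lt_min => /andP[zr zd].
change ((normc (f z - f z0))%:C%C < d%:C%C); rewrite ltcR f0.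
have zr2 : normc (z - z0) <= normc z1 / 2 by rewrite nz1; lra.
have zr1 : normc (z - z0) < r by lra.
have := hM (z - z0) (f z) zr2 (ha z zr1).
move: zd; rewrite ltr_pdivlMr //; have := normc_ge0 (z - z0); nra.
Qed.

End Continuation.

(** * Limits along punctured neighbourhoods *)

Section Limits.
Variable R : realType.
Local Notation C := R[i].

Definition tends (f : C -> C) (z0 l : C) : Prop :=
  (f : C^o -> C^o) z @[z --> (z0 : C^o)^'] --> (l : C^o).

Lemma tends_cst c z0 : tends (fun=> c) z0 c.
Proof. exact: cvg_cst. Qed.

Lemma tends_id z0 : tends id z0 z0.
Proof. exact: nbhs_dnbhs. Qed.

Lemma tendsD f h z0 a b : tends f z0 a -> tends h z0 b ->
  tends (fun z => f z + h z) z0 (a + b).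
Proof. exact: (@cvgD C C^o C^o). Qed.

Lemma tendsN f z0 a : tends f z0 a -> tends (fun z => - f z) z0 (- a).
Proof. exact: (@cvgN C C^o C^o). Qed.

Lemma tendsM f h z0 a b : tends f z0 a -> tends h z0 b ->
  tends (fun z => f z * h z) z0 (a * b).
Proof. exact: (@cvgM C C^o). Qed.

Lemma tendsV f z0 a : a != 0 -> tends f z0 a -> tends (fun z => (f z)^-1) z0 a^-1.
Proof. exact: (@cvgV C C^o). Qed.

Lemma tendsX f z0 a k : tends f z0 a -> tends (fun z => f z ^+ k) z0 (a ^+ k).
Proof.
move=> fa; elim: k => [|k IH]; first exact: tends_cst.
have -> : (fun z => f z ^+ k.+1) = (fun z => f z * f z ^+ k).
  by apply/funext => z; rewrite exprS.
by rewrite exprS; exact: tendsM.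
Qed.

Lemma tends_sum (I : Type) (r : seq I) (P : pred I) (f : I -> C -> C) z0 (a : I -> C) :
  (forall i, P i -> tends (f i) z0 (a i)) ->
  tends (fun z => \sum_(i <- r | P i) f i z) z0 (\sum_(i <- r | P i) a i).
Proof.
move=> fa; elim: r => [|i r IH].
  have -> : (fun z => \sum_(i <- [::] | P i) f i z) = (fun=> 0).
    by apply/funext => z; rewrite big_nil.
  by rewrite big_nil; exact: tends_cst.
have -> : (fun z => \sum_(j <- i :: r | P j) f j z) =
    (fun z => (if P i then f i z else 0) + \sum_(j <- r | P j) f j z).
  by apply/funext => z; rewrite big_cons; case: ifP; rewrite ?add0r.
have -> : \sum_(j <- i :: r | P j) a j = (if P i then a i else 0) + \sum_(j <- r | P j) a j.
  by rewrite big_cons; case: ifP; rewrite ?add0r.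
apply: tendsD; last exact: IH.
by case: ifP => [/fa|_]; last exact: tends_cst.
Qed.

Lemma tends_uniq f z0 a b : tends f z0 a -> tends f z0 b -> a = b.
Proof. exact: (@cvg_unique C^o). Qed.

Lemma tends_near f h z0 a : (\forall z \near (z0 : C^o)^', f z = h z) ->
  tends f z0 a -> tends h z0 a.
Proof.
move=> fh; apply: cvg_trans; apply: near_eq_cvg.
by apply: filterS fh => z ->.
Qed.

(** The map z -> 1/(qz) is continuous at u, and its injectivity keeps the puncture. *)
Lemma near_inv (q u : C) (Q : C -> Prop) : q != 0 -> u != 0 ->
  (\forall w \near (((q * u)^-1 : C) : C^o)^', Q w) ->
  \forall z \near (u : C^o)^', Q (q * z)^-1.
Proof.
move=> q0 u0 hQ; have qu0 : q * u != 0 by rewrite mulf_neq0.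
have /(_ _ hQ) h : tends (fun z => (q * z)^-1) u (q * u)^-1.
  by apply: tendsV => //; apply: tendsM; [exact: tends_cst | exact: tends_id].
have /= ne : \forall z \near (u : C^o)^', z != u.
  by apply/dnearCP; exists 1.
near=> z.
have zu : z != u by near: z.
have : (q * z)^-1 != (q * u)^-1 -> Q (q * z)^-1 by near: z; exact: h.
by apply; rewrite (inj_eq invr_inj) (inj_eq (mulfI q0)).
Unshelve. all: by end_near. Qed.

Lemma tends_comp_inv (q u : C) f a : q != 0 -> u != 0 ->
  tends f (q * u)^-1 a -> tends (fun z => f (q * z)^-1) u a.
Proof.
move=> q0 u0 fa A /fa h; exact: (near_inv q0 u0 h).
Qed.

End Limits.

(** * Meromorphic continuation and its functional equation *)

Section Main.
Variables (R : realType) (F : finFieldType) (p : nat).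
Variable charFp : p \in [pchar F].
Variables g l : {poly F}.
Hypothesis g_monic : g \is monic.
Hypothesis g_deg : (0 < deg g)%N.
Hypothesis l_dvd_g : l %| g.
Variable chi : {poly F} -> R[i].
Hypothesis chiP : dirichlet_character l chi.
Local Notation C := R[i].
Local Notation q := (#|F|%:R : C).
Local Notation P := (estermann_poly charFp g chi).

Lemma norm_lt_inv_q u : `|u| < q^-1 -> q * u != 1.
Proof.
apply: contraTneq => qu1; have q0 := q_neq0 F C.
have -> : u = q^-1 by apply: (mulfI q0); rewrite qu1 mulfV.
by rewrite ger0_norm ?invr_ge0 ?ler0n // ltxx.
Qed.

Lemma R2_psum c u : `|u| < q^-1 ->
  psum_to (R2_coef charFp chi c g) u ((P c).[u] / (1 - q * u) ^+ 2).
Proof.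
move=> uq; have q0 : 0 < q by rewrite lt0r q_neq0 ler0n.
have qu : normc (q * u) < 1.
  rewrite -ltcR; change (`|q * u| < 1 :> C); rewrite normrM gtr0_norm //.
  by rewrite -[X in _ < X](mulfV (lt0r_neq0 q0)) ltr_pM2l.
apply: psum_to_ext (psum_to_geo_iter (k := 2) qu (@psum_to_poly _ (P c) u)) => N.
by rewrite (R2_coefE charFp g_monic g_deg l_dvd_g chiP).
Qed.

Lemma is_R2_exists c : exists G, is_R2 charFp chi c g G.
Proof.
have [G [Gmer GE]] := meromorphic_ratio (P c) 2 (q_neq0 F C).
exists G; split=> // u uq; rewrite GE; first exact: R2_psum.
exact: norm_lt_inv_q.
Qed.

(** For |z| < 1/q the function f is the sum of the series, hence the rational function; the identity
    theorem spreads this to every point. *)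
Lemma is_R2_near c f z0 : is_R2 charFp chi c g f ->
  \forall z \near (z0 : C^o)^', q * z != 1 -> f z = estermann charFp g chi c z.
Proof.
move=> [fmer fsum].
have q0 : 0 < q by rewrite lt0r q_neq0 ler0n.
have : \forall z \near (0 : C^o)^', (1 - q * z) ^+ 2 * f z = (P c).[z].
  have /posC_real [e e0 eE] : 0 < q^-1 by rewrite invr_gt0.
  apply/dnearCP; exists e => // z _; rewrite subr0 => ze.
  have zq : `|z| < q^-1 by rewrite eE normr_normc ltcR.
  have qz : 1 - q * z != 0.
    by rewrite subr_eq0 eq_sym norm_lt_inv_q.
  by rewrite (psum_to_uniq (fsum z zq) (R2_psum zq)) mulrC divfK // expf_neq0.
move=> /(meromorphic_ratio_unique fmer) /(_ z0); apply: filterS => z h qz.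
have w0 : (1 - q * z) ^+ 2 != 0 by rewrite expf_neq0 // subr_eq0 eq_sym.
by apply: (mulfI w0); rewrite h estermann_polyE.
Qed.

(** Both sides are continuous at u by analyticity and agree on a punctured neighbourhood, so they
    agree at u; this also settles u = 1, which [estermann_functional] excludes. *)
Lemma estermann_functional_equation (c cbar : {poly F}) (R2c : C -> C)
    (R2cbar : F -> C -> C) (u : C) :
  coprimep c g -> g %| c * cbar - 1 -> is_R2 charFp chi c g R2c ->
  (forall lambda, lambda != 0 -> is_R2 charFp chi (lambda *: cbar) g (R2cbar lambda)) ->
  u != 0 -> q * u != 1 -> analytic_at R2c u ->
  (forall lambda, lambda != 0 -> analytic_at (R2cbar lambda) (q * u)^-1) ->
  R2c u = (chi (- c))^* * (q * u ^+ 2) ^+ (deg g - 1) *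
    \sum_(lambda : F | lambda != 0)
      calB charFp chi lambda u * R2cbar lambda (q * u)^-1.
Proof.
move=> cg ccb Rc Rcbar u0 qu1 anc ancbar.
have q0 := q_neq0 F C.
have tc : tends R2c u (R2c u) := analytic_cvg anc.
have tq : tends (fun z => q * z) u (q * u) := tendsM (@tends_cst _ q u) (@tends_id _ u).
pose rhs z := (chi (- c))^* * (q * z ^+ 2) ^+ (deg g - 1) *
    \sum_(lambda : F | lambda != 0)
      calB charFp chi lambda z * R2cbar lambda (q * z)^-1.
have trhs : tends rhs u (rhs u).
  apply: tendsM.
    apply: tendsM; first exact: tends_cst.
    apply: tendsX; apply: tendsM; first exact: tends_cst.
    exact/tendsX/tends_id.
  apply: tends_sum => lambda l0; apply: tendsM; last first.
    apply: (tends_comp_inv q0 u0); exact: (analytic_cvg (ancbar lambda l0)).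
  apply: tends_sum => e1 _; apply: tends_sum => e2 _.
  apply: tendsM; first exact: tends_cst.
  apply: tendsM; first exact: tends_cst.
  apply: tendsV; first by rewrite mulf_neq0 // expf_neq0 // subr_eq0 eq_sym.
  apply: tendsM; first exact: tends_cst.
  apply: tendsX; apply: tendsD; first exact: tends_cst.
  exact: tendsN tq.
apply: (tends_uniq _ trhs); apply: tends_near tc.
have nc := is_R2_near u Rc.
have ncbar : \forall z \near (u : C^o)^', forall lambda, lambda != 0 ->
    q * (q * z)^-1 != 1 -> R2cbar lambda (q * z)^-1 =
      estermann charFp g chi (lambda *: cbar) (q * z)^-1.
  (* The finitely many lambda admit a common neighbourhood. *)
  apply: filter_forall => lambda; have [->|l0] := eqVneq lambda 0.
    exact: nearW.
  have := near_inv q0 u0 (is_R2_near (q * u)^-1 (Rcbar lambda l0)).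
  by apply: filterS => z h _.
have zneq a : a != u -> \forall z \near (u : C^o)^', z != a.
  move=> au; apply/dnearCP; exists (normc (a - u)).
    by rewrite lt0r normc_ge0 normc_eq0 subr_eq0 au.
  by move=> z _; apply: contraTneq => ->; rewrite ltxx.
have nu : \forall z \near (u : C^o)^', z != u.
  by apply/dnearCP; exists 1.
(* Applied to 0, 1 and 1/q, any of which is avoided either by shrinking or by the puncture. *)
have notu a : \forall z \near (u : C^o)^', z != a.
  by have [->|/zneq] := eqVneq a u.
near=> z.
have z0 : z != 0 by near: z; exact: notu.
have z1 : z != 1 by near: z; exact: notu.
have zq : q * z != 1.
  have : z != q^-1 by near: z; exact: notu.
  by apply: contraNneq => qz; apply/eqP/(mulfI q0); rewrite qz mulfV.
have hc : q * z != 1 -> R2c z = estermann charFp g chi c z by near: z.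
rewrite (hc zq) (estermann_functional charFp g_monic g_deg l_dvd_g chiP cg ccb) //.
rewrite /rhs subn1; congr (_ * _); apply: eq_bigr => lambda l0; congr (_ * _).
have hl : forall lambda, lambda != 0 ->
    q * (q * z)^-1 != 1 -> R2cbar lambda (q * z)^-1 =
      estermann charFp g chi (lambda *: cbar) (q * z)^-1 by near: z.
by rewrite hl // invfM mulVKf // invr_eq1.
Unshelve. all: by end_near. Qed.

End Main.

Theorem proposition3p15 (R : realType) (F : finFieldType) (p : nat)
    (charFp : p \in [pchar F]) (g l c cbar : {poly F})
    (chi : {poly F} -> R[i])
    (g_monic : g \is monic) (g_deg : (1 <= deg g)%N) (l_monic : l \is monic)
    (l_dvd_g : l %| g) (c_coprime_g : coprimep c g)
    (chi_primitive : primitive_character l chi)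
    (cbar_inverse : g %| c * cbar - 1) :
  (forall a : {poly F}, coprimep a g ->
     exists G : R[i] -> R[i], is_R2 charFp chi a g G) /\
  forall (R2c : R[i] -> R[i]) (R2cbar : F -> R[i] -> R[i]),
    is_R2 charFp chi c g R2c ->
    (forall lambda : F, lambda != 0 ->
       is_R2 charFp chi (lambda *: cbar) g (R2cbar lambda)) ->
    forall u : R[i], u != 0 -> #|F|%:R * u != 1 ->
      analytic_at R2c u ->
      (forall lambda : F, lambda != 0 ->
         analytic_at (R2cbar lambda) (#|F|%:R * u)^-1) ->
      R2c u =
        (chi (- c))^* * (#|F|%:R * u ^+ 2) ^+ (deg g - 1) *
        \sum_(lambda : F | lambda != 0)
          calB charFp chi lambda u * R2cbar lambda (#|F|%:R * u)^-1.
Proof.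
have [chiP _] := chi_primitive; split=> [a _|R2c R2cbar Rc Rcbar u u0 qu1].
  exact: (is_R2_exists charFp g_monic g_deg l_dvd_g chiP).
exact: (estermann_functional_equation g_monic g_deg l_dvd_g chiP
  c_coprime_g cbar_inverse Rc Rcbar u0 qu1).
Qed.
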